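(* Let $F$ be a field of characteristic $2$ and let $E=F(\alpha)$ be a simple field extension of $F$ with $[E:F]=4$. Let $f(X)=X^4+aX^3+bX^2+cX+d\in F[X]$ be the minimal polynomial of $\alpha$ over $F$, and assume that one of the following holds: Case 1 ($E/F$ separable): $b=0$ and $a\neq 0$; Case 2 ($E/F$ inseparable but not purely inseparable): $a=c=0$ and $b\neq 0$; Case 3 ($E/F$ purely inseparable): $a=b=c=0$. Let $f_C(X)=X^3+bX^2+acX+(a^2d+c^2)\in F[X]$ be the cubic resolvent of $f$. Then the quadratic Witt kernel $W_q(E/F)$ is generated as a $WF$-module by (the Witt classes of) the following quadratic forms: (a) $[1,g]$ for those $g\in F$ such that $F(\wp^{-1}(g))\subset E$; (b) $\langle\!\langle g,h]]$ for $h\in F$ and those $g\in F^*$ with $F(\sqrt{g})\subset E$; (c) $\langle\!\langle f_C(e),\frac{d}{e^2}]]$ for $e\in F^*$ with $f_C(e)\neq 0$; (d) (only in Case 2) $\langle\!\langle b,d,h]]$ with $h\in F$.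
   Context: All forms are finite-dimensional, $F$ has characteristic $2$. For a quadratic form $q$ on an $F$-vector space $V$ put $b_q(x,y)=q(x+y)-q(x)-q(y)$; $q$ is nonsingular if the radical of $b_q$ is $0$. For $u,v\in F$, $[u,v]$ denotes the binary quadratic form $ux^2+xy+vy^2$. The hyperbolic plane is $\mathbb{H}=[0,0]$; a hyperbolic form is an orthogonal sum of hyperbolic planes. Every nonsingular quadratic form has an anisotropic part, unique up to isometry; two nonsingular quadratic forms are Witt equivalent if their anisotropic parts are isometric. $W_qF$ is the group of Witt equivalence classes of nonsingular quadratic forms over $F$ under orthogonal sum. $WF$ is the Witt ring of nonsingular symmetric bilinear forms over $F$ (addition: orthogonal sum, multiplication: tensor product). $W_qF$ is a $WF$-module, with $\langle a_1,\ldots,a_n\rangle_b\otimes q\cong a_1q\perp\ldots\perp a_nq$, where $\langle a_1,\ldots,a_n\rangle_b$ is the diagonal bilinear form. $W_q(E/F)$ is the kernel of the scalar extension map $W_qF\to W_qE$, $q\mapsto q_E$. Bilinear Pfister forms: $\langle\!\langle a_1,\ldots,a_n\rangle\!\rangle_b=\langle 1,-a_1\rangle_b\otimes\cdots\otimes\langle 1,-a_n\rangle_b$, $a_i\in F^*$. Quadratic Pfister forms: $\langle\!\langle a_1,\ldots,a_n,c]]=\langle\!\langle a_1,\ldots,a_n\rangle\!\rangle_b\otimes[1,c]$, $a_i\in F^*$, $c\in F$ (an $(n+1)$-fold quadratic Pfister form). For $g\in F$, $\wp^{-1}(g)$ denotes a root of $X^2+X+g$ in an algebraic closure of $F$. 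*)

(* Defs.v *)
From mathcomp Require Import all_boot all_order all_algebra all_field.
From mathcomp.real_closed Require Import mxtens.

Set Implicit Arguments.
Unset Strict Implicit.
Unset Printing Implicit Defensive.

Import GRing.Theory.
Local Open Scope ring_scope.

(* A quadratic form on F^n is given by a coefficient matrix A, not assumed
   symmetric, as x |-> x A x^T = \sum_(i, j) A i j x_i x_j; every quadratic
   form on F^n arises in this way.  Two matrices give the same form iff they
   differ by an alternating matrix, so forms are never compared through their
   matrices, only through their values (see [isometric]). *)
Record qform (F : fieldType) := QForm { qdim : nat; qmx : 'M[F]_qdim }.

(* A bilinear form on F^n is given by its Gram matrix. *)
Record bform (F : fieldType) := BForm { bdim : nat; bmx : 'M[F]_bdim }.

Section Forms.
Variable F : fieldType.
Implicit Types (q : qform F) (B : bform F).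

Definition qeval q (x : 'rV[F]_(qdim q)) : F := (x *m qmx q *m x^T) 0 0.

Definition polar q (x y : 'rV[F]_(qdim q)) : F :=
  qeval (x + y) - qeval x - qeval y.

Definition nonsingular q : Prop :=
  forall x : 'rV[F]_(qdim q), (forall y, polar x y = 0) -> x = 0.

Definition anisotropic q : Prop :=
  forall x : 'rV[F]_(qdim q), qeval x = 0 -> x = 0.

Definition isometric q1 q2 : Prop :=
  exists2 f : {linear 'rV[F]_(qdim q1) -> 'rV[F]_(qdim q2)},
    bijective f & forall x, qeval (f x) = qeval x.

Definition qzero : qform F := QForm (0 : 'M[F]_0).

Definition qorth q1 q2 : qform F := QForm (block_mx (qmx q1) 0 0 (qmx q2)).

Definition qbin (u v : F) : qform F :=
  QForm (block_mx u%:M 1%:M 0 v%:M : 'M[F]_(1 + 1)).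

Definition hyperbolic (m : nat) : qform F := iter m (qorth (qbin 0 0)) qzero.

Definition anisotropic_part q phi : Prop :=
  anisotropic phi /\ exists m, isometric q (qorth phi (hyperbolic m)).

Definition witt_equiv q1 q2 : Prop :=
  exists phi1 phi2, [/\ anisotropic_part q1 phi1, anisotropic_part q2 phi2
                      & isometric phi1 phi2].

Definition nonsingular_symmetric B : Prop :=
  (bmx B)^T = bmx B /\ bmx B \in unitmx.

Definition bdiag (s : seq F) : bform F :=
  BForm (diag_mx (\row_(i < size s) s`_i)).

Definition btens B1 B2 : bform F := BForm (bmx B1 *t bmx B2).

(* The action of bilinear forms on quadratic forms: for B symmetric this is
   the form on the tensor product taking the value B(v, v) q(w) at v (x) w and
   having the tensor product of B and b_q as its polar form. *)
Definition bqtens B q : qform F := QForm (bmx B *t qmx q).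

(* The empty list gives <1>, the unit for the tensor product. *)
Definition bpfister (s : seq F) : bform F :=
  foldr (fun a => btens (bdiag [:: 1; - a])) (bdiag [:: 1]) s.

Definition qpfister (s : seq F) (c : F) : qform F :=
  bqtens (bpfister s) (qbin 1 c).

(* The class of q lies in the WF-submodule of W_qF generated by the classes of
   the forms in S. *)
Definition in_WF_span (S : qform F -> Prop) q : Prop :=
  exists n (B : 'I_n -> bform F) (G : 'I_n -> qform F),
    [/\ forall i, nonsingular_symmetric (B i), forall i, S (G i)
      & witt_equiv q (\big[qorth/qzero]_(i < n) bqtens (B i) (G i))].

End Forms.

Section WittKernel.
Variables (F : fieldType) (E : fieldExtType F).

Definition qext (q : qform F) : qform E := QForm (map_mx (in_alg E) (qmx q)).

Definition in_witt_kernel (q : qform F) : Prop :=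
  witt_equiv (qext q) (qzero E).

Definition generates_witt_kernel (S : qform F -> Prop) : Prop :=
  forall q, nonsingular q -> (in_witt_kernel q <-> in_WF_span S q).

End WittKernel.

Section Quartic.
Variables (F : fieldType) (E : fieldExtType F) (a b c d : F).

Definition quartic : {poly F} :=
  'X^4 + a *: 'X^3 + b *: 'X^2 + c *: 'X + d%:P.

Definition cubic_resolvent : {poly F} :=
  'X^3 + b *: 'X^2 + (a * c) *: 'X + (a ^+ 2 * d + c ^+ 2)%:P.

Definition separable_case : Prop :=
  separable 1 {:E} /\ (b = 0 /\ a != 0).

Definition mixed_case : Prop :=
  [/\ ~~ separable 1 {:E}, ~~ purely_inseparable 1 {:E}
    & [/\ a = 0, c = 0 & b != 0]].

Definition purely_inseparable_case : Prop :=
  purely_inseparable 1 {:E} /\ [/\ a = 0, b = 0 & c = 0].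

(* As E / F is algebraic, an algebraic closure of F may be taken to contain E;
   then F(r) is contained in E iff r belongs to E, and for r a root of
   X^2 + X + g this does not depend on the choice of the root. *)
Inductive kernel_generator : qform F -> Prop :=
| Gen_artin_schreier (g : F) :
    (exists x : E, root ('X^2 + 'X + (g%:A)%:P) x) ->
    kernel_generator (qbin 1 g)
| Gen_sqrt (g h : F) :
    g != 0 -> (exists x : E, x ^+ 2 = g%:A) ->
    kernel_generator (qpfister [:: g] h)
| Gen_resolvent (e : F) :
    e != 0 -> cubic_resolvent.[e] != 0 ->
    kernel_generator (qpfister [:: cubic_resolvent.[e]] (d / e ^+ 2))
| Gen_mixed (h : F) :
    mixed_case -> kernel_generator (qpfister [:: b; d] h).

End Quartic.

(* Main.v *)
Require Import Defs.
From HB Require Import structures.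
From mathcomp Require Import all_boot all_order all_algebra all_field.
From mathcomp Require Import ring zify.
From mathcomp.real_closed Require Import mxtens.
From Stdlib Require Import Classical.

(** The theorem is proved by splitting generators off a form until nothing is
left; everything rests on one count of dimensions.

Let q be a nonsingular form on V = F^n which becomes hyperbolic over E, that is,
V_E has a totally singular subspace L of dimension n/2 over E.  Suppose that q is
anisotropic.  The vectors x alpha^2 + y alpha + z with x, y, z in V form an
F-subspace of dimension 3n in V_E, and L has codimension 2n over F, so L contains
at least n independent vectors of this shape.  None of them but 0 has x = 0: from
q(y alpha + z) = 0 it would follow that q(y) = q(z) = 0, as 1, alpha, alpha^2 are
independent over F.  Hence y = xP and z = xR for two endomorphisms P and R of V
defined for all x ([isotropic_quadratic_sections]).  Comparing q(x alpha^2 + xP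
alpha + xR) = 0 with the minimal polynomial gives
([section_identities])
    b_q(x, xP) = a q(x),          b_q(x, xR) + q(xP) = b q(x),
    b_q(xP, xR) = c q(x),         q(xR) = d q(x).

If b_q(x, xR) is nonzero for some x, put s = q(x) and e = b_q(x, xR) / s.  The plane
spanned by x and xR/e is isometric to s [1, d/e^2], and the component of xP
orthogonal to it takes the value s f_C(e) / e^2.  Either this component is nonzero
and q shares a subspace of dimension 3 with the 4-dimensional form
s <<f_C(e), d/e^2]], or it is zero and [1, d/e^2] is isotropic over E, which gives
a generator of type (a) ([resolvent_overlap]).

If b_q(x, xR) = 0 for all x, then P multiplies q by b and R multiplies q by d.  In
the separable case b = 0 forces P = 0 and then a = 0, which is excluded.  In the
purely inseparable case x and xR span a form similar to the totally singular form
<1, d>, which together with a vector dual to x makes a subspace of dimension 3 of a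
multiple of <<d, h]].  In the mixed case x, xR, xP, xRP span a form similar to
<1, d, b, bd>; if the latter is anisotropic, q shares a subspace of dimension 5
with a multiple of <<b, d, h]], and otherwise b or d is a square in E and not in F,
which leads to a generator of type (b) ([mixed_overlap], [sqrt_overlap]).

In each case q and s gamma, for some generator gamma, share a subspace of dimension
more than half of dim gamma.  The diagonal of this subspace is totally singular in
the orthogonal sum of q and s gamma, as 2 = 0, so this sum is Witt equivalent to
a form of dimension smaller than n ([overlap_reduction]), and induction applies
([kernel_in_span]).  This uses that the generators lie in the kernel, which for (c)
amounts to the identity that f_C(e) is the norm over E of
(e alpha^2 + c alpha, e (e + a alpha)) / alpha for the form [1, d/e^2]
([resolvent_norm]).

Witt equivalence is handled through totally singular subspaces of half the
dimension: nonsingular forms are Witt equivalent iff their orthogonal sum has one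
([witt_equivP]). *)

Set Implicit Arguments.
Unset Strict Implicit.
Unset Printing Implicit Defensive.

Import GRing.Theory.
Local Open Scope ring_scope.

(** * Polar forms and isometries *)

Section Gram.
Variable F : fieldType.
Implicit Types (q : qform F).

Definition gram q : 'M[F]_(qdim q) := qmx q + (qmx q)^T.

Definition restr q k (C : 'M[F]_(k, qdim q)) : qform F :=
  QForm (C *m qmx q *m C^T).

Lemma mulmx_tr11 m n (x : 'rV[F]_m) (A : 'M_(m, n)) (y : 'rV_n) :
  (x *m A *m y^T) 0 0 = (y *m A^T *m x^T) 0 0.
Proof.
have tr11 (M : 'M[F]_1) : M 0 0 = M^T 0 0 by rewrite mxE.
by rewrite tr11 !trmx_mul trmxK mulmxA.
Qed.

Lemma row_mulmx_eq0 m n (x : 'rV[F]_m) (A : 'M_(m, n)) :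
  (forall y : 'rV_n, (x *m A *m y^T) 0 0 = 0) -> x *m A = 0.
Proof.
move=> xA0; apply/rowP => j.
by have := xA0 (delta_mx 0 j); rewrite trmx_delta -colE !mxE.
Qed.

Lemma polarE q x y : @polar F q x y = (x *m gram q *m y^T) 0 0.
Proof.
rewrite /polar /qeval /gram linearD /= !mulmxDl !mulmxDr !mulmxDl !mxE.
have := mulmx_tr11 x (qmx q)^T y; rewrite trmxK !mxE => ->; ring.
Qed.

Lemma gram_sym q : (gram q)^T = gram q.
Proof. by rewrite /gram linearD /= trmxK addrC. Qed.

Lemma polarC q x y : @polar F q x y = polar y x.
Proof. by rewrite !polarE mulmx_tr11 gram_sym. Qed.

Lemma polarDl q x y z : @polar F q (x + y) z = polar x z + polar y z.
Proof. by rewrite !polarE !mulmxDl mxE. Qed.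

Lemma polarZl q k x z : @polar F q (k *: x) z = k * polar x z.
Proof. by rewrite !polarE -!scalemxAl mxE. Qed.

Lemma polarDr q x y z : @polar F q z (x + y) = polar z x + polar z y.
Proof. by rewrite polarC polarDl !(polarC z). Qed.

Lemma polarZr q k x z : @polar F q z (k *: x) = k * polar z x.
Proof. by rewrite polarC polarZl (polarC z). Qed.

Lemma polar0l q x : @polar F q 0 x = 0.
Proof. by rewrite polarE !mul0mx mxE. Qed.

Lemma qevalD q x y : qeval (x + y) = qeval x + qeval y + @polar F q x y.
Proof. by rewrite /polar; ring. Qed.

Lemma qevalZ q k x : @qeval F q (k *: x) = k ^+ 2 * qeval x.
Proof. by rewrite /qeval linearZ /= -!scalemxAl -!scalemxAr !mxE expr2 mulrA. Qed.

Lemma qeval0 q : @qeval F q 0 = 0.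
Proof. by rewrite /qeval !mul0mx mxE. Qed.

Lemma qeval_restr q k (C : 'M[F]_(k, qdim q)) (x : 'rV_k) :
  @qeval F (restr C) x = qeval (x *m C).
Proof. by rewrite /qeval /= trmx_mul !mulmxA. Qed.

Lemma gram_restr q k (C : 'M[F]_(k, qdim q)) :
  gram (restr C) = C *m gram q *m C^T.
Proof. by rewrite /gram /= !trmx_mul trmxK mulmxDr mulmxDl !mulmxA. Qed.

Lemma nonsingularP q : nonsingular q <-> gram q \in unitmx.
Proof.
split=> [nsq | uG x x0].
  rewrite -row_free_unit; apply: inj_row_free => v vG0; apply: nsq => y.
  by rewrite polarE vG0 mul0mx mxE.
have/row_mulmx_eq0 xG : forall y : 'rV_(qdim q), (x *m gram q *m y^T) 0 0 = 0.
  by move=> y; rewrite -polarE x0.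
by rewrite -(mulmxK uG x) xG mul0mx.
Qed.

Lemma qeval_orth q1 q2 (x : 'rV_(qdim q1 + qdim q2)) :
  @qeval F (qorth q1 q2) x = qeval (lsubmx x) + qeval (rsubmx x).
Proof.
rewrite /qeval /= -{1 2}[x]hsubmxK tr_row_mx mul_row_block mul_row_col.
by rewrite !mulmx0 addr0 add0r mxE.
Qed.

Lemma gram_orth q1 q2 :
  gram (qorth q1 q2) = block_mx (gram q1) 0 0 (gram q2).
Proof. by rewrite /gram /= tr_block_mx add_block_mx !trmx0 !addr0. Qed.

Lemma nonsingular_orth q1 q2 :
  nonsingular (qorth q1 q2) <-> nonsingular q1 /\ nonsingular q2.
Proof.
rewrite !nonsingularP gram_orth !unitmxE det_ublock unitrM.
by split=> [/andP[]|[-> ->]].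
Qed.

Lemma totally_singular_polar q r (U : 'M[F]_(r, qdim q)) :
  (forall x : 'rV_r, @qeval F q (x *m U) = 0) -> U *m gram q *m U^T = 0.
Proof.
move=> U0; apply/row_matrixP => i; rewrite row0 rowE !mulmxA.
have UP y : polar (delta_mx 0 i *m U) (y *m U) = 0.
  by rewrite /polar -mulmxDl !U0 !subr0.
apply/rowP => j; have := UP (delta_mx 0 j).
by rewrite polarE trmx_mul trmx_delta !mulmxA -colE mxE => ->; rewrite mxE.
Qed.

Lemma isometric_mx q1 q2 (A : 'M[F]_(qdim q1, qdim q2)) :
    row_free A -> (qdim q2 <= qdim q1)%N ->
    (forall x : 'rV_(qdim q1), @qeval F q2 (x *m A) = qeval x) ->
  isometric q1 q2.
Proof.
move=> Af le_q qA; exists (mulmxr A) => //.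
have Afull : row_full A by rewrite -col_leq_rank (eqP Af).
exists (mulmxr (pinvmx A)) => x /=; first exact: mulmxKp.
by rewrite -mulmxA mulVpmx ?mulmx1.
Qed.

Lemma isometric_mxP q1 q2 : isometric q1 q2 ->
  exists A : 'M[F]_(qdim q1, qdim q2),
    [/\ row_free A, qdim q1 = qdim q2
      & forall x : 'rV_(qdim q1), @qeval F q2 (x *m A) = qeval x].
Proof.
case=> f [g fK gK] qf; exists (lin1_mx f).
have Af : row_free (lin1_mx f).
  apply: inj_row_free => v; rewrite mul_rV_lin1 => fv0.
  by rewrite -[v]fK fv0 -[RHS]fK linear0.
split=> // [|x]; last by rewrite mul_rV_lin1 qf.
rewrite -(eqP Af); apply/eqP; rewrite -[_ == _]/(row_full _) -sub1mx.
apply/row_subP => i; have -> : row i 1%:M = g (row i 1%:M) *m lin1_mx f.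
  by rewrite mul_rV_lin1 gK.
exact: submxMl.
Qed.

Lemma isometric_refl q : isometric q q.
Proof.
apply: (@isometric_mx q q 1%:M) => // [|x]; last by rewrite mulmx1.
by rewrite row_free_unit unitmx1.
Qed.

Lemma isometric_sym q1 q2 : isometric q1 q2 -> isometric q2 q1.
Proof.
move=> /isometric_mxP[A [Af eqd qA]].
have Afull : row_full A by rewrite -col_leq_rank (eqP Af) eqd.
apply: (@isometric_mx _ _ (pinvmx A)); rewrite ?eqd //.
  exact: pinvmx_free.
by move=> x; rewrite -qA -mulmxA mulVpmx ?mulmx1.
Qed.

Lemma isometric_trans q2 q1 q3 :
  isometric q1 q2 -> isometric q2 q3 -> isometric q1 q3.
Proof.
move=> [f bf qf] [g bg qg]; exists (g \o f) => [|x /=].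
  exact: bij_comp.
by rewrite qg qf.
Qed.

Lemma isometric_dim q1 q2 : isometric q1 q2 -> qdim q1 = qdim q2.
Proof. by case/isometric_mxP => A []. Qed.

Lemma isometric_orth q1 q1' q2 q2' :
  isometric q1 q1' -> isometric q2 q2' ->
  isometric (qorth q1 q2) (qorth q1' q2').
Proof.
move=> /isometric_mxP[A [Af dA qA]] /isometric_mxP[B [Bf dB qB]].
apply: (@isometric_mx (qorth q1 q2) (qorth q1' q2') (block_mx A 0 0 B)) => [||x] /=.
- apply: inj_row_free => v; rewrite -[v]hsubmxK mul_row_block !mulmx0.
  rewrite addr0 add0r -[0]row_mx0 => /eq_row_mx[vA vB].
  rewrite -[RHS]row_mx0; congr row_mx; apply/eqP.
    by rewrite -(mulmx_free_eq0 _ Af) vA.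
  by rewrite -(mulmx_free_eq0 _ Bf) vB.
- by rewrite dA dB.
rewrite !qeval_orth -{1 2}[x]hsubmxK mul_row_block !mulmx0 addr0 add0r.
by rewrite row_mxKl row_mxKr qA qB.
Qed.

Lemma isometric_orthC q1 q2 : isometric (qorth q1 q2) (qorth q2 q1).
Proof.
apply: (@isometric_mx (qorth q1 q2) (qorth q2 q1) (block_mx 0 1%:M 1%:M 0)) => [||x] /=.
- apply: inj_row_free => v; rewrite -[v]hsubmxK mul_row_block !mulmx0 !mulmx1.
  by rewrite addr0 add0r -[0]row_mx0 => /eq_row_mx[-> ->]; rewrite row_mx0.
- by rewrite addnC.
rewrite !qeval_orth -{1 2}[x]hsubmxK mul_row_block !mulmx0 !mulmx1 addr0 add0r.
by rewrite row_mxKl row_mxKr addrC.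
Qed.

Lemma isometric_orthA q1 q2 q3 :
  isometric (qorth q1 (qorth q2 q3)) (qorth (qorth q1 q2) q3).
Proof.
pose f (x : 'rV[F]_(qdim q1 + (qdim q2 + qdim q3))) :=
  row_mx (row_mx (lsubmx x) (lsubmx (rsubmx x))) (rsubmx (rsubmx x)).
have linf : linear f.
  by move=> k x y; rewrite /f !linearP /= -!add_row_mx -!scale_row_mx.
pose fL := GRing.isLinear.Build _ _ _ _ f linf.
pose fl : {linear _ -> _} := HB.pack f fL.
exists fl => [|x] /=; last first.
  by rewrite !qeval_orth /f !(row_mxKl, row_mxKr) addrA.
exists (fun y => row_mx (lsubmx (lsubmx y)) (row_mx (rsubmx (lsubmx y)) (rsubmx y))).
  by move=> x; rewrite /= /f !(row_mxKl, row_mxKr) !hsubmxK.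
by move=> x; rewrite /= /f !(row_mxKl, row_mxKr) !hsubmxK.
Qed.

Lemma isometric_orth0 q : isometric (qorth q (qzero F)) q.
Proof.
apply: isometric_sym; apply: (@isometric_mx q (qorth q (qzero F)) (row_mx 1%:M 0)) => [||x] /=.
- apply: inj_row_free => v; rewrite mul_mx_row mulmx1 mulmx0.
  by move/(congr1 lsubmx); rewrite row_mxKl linear0.
- by rewrite addn0.
by rewrite qeval_orth mul_mx_row mulmx1 mulmx0 row_mxKl row_mxKr qeval0 addr0.
Qed.

Lemma nonsingular_isometric q1 q2 :
  isometric q1 q2 -> nonsingular q1 -> nonsingular q2.
Proof.
move=> [f [g fK gK] qf] ns1 x x0.
rewrite -[x]gK (ns1 (g x)) ?linear0 // => y.
by rewrite /polar -!qf linearD !gK -(x0 (f y)).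
Qed.

End Gram.

(** * Totally singular subspaces *)

Lemma kernel_basis (F : fieldType) m n (M : 'M[F]_(m, n)) :
  exists r (K : 'M[F]_(r, m)),
    [/\ row_free K, K *m M = 0 & (r + \rank M)%N = m].
Proof.
exists _, (row_base (kermx M)); split; first exact: row_base_free.
  have /submxP[Z ->] : (row_base (kermx M) <= kermx M)%MS by rewrite eq_row_base.
  by rewrite -mulmxA mulmx_ker mulmx0.
by rewrite mxrank_ker subnK ?rank_leq_row.
Qed.

Section Lagrangian.
Variable F : fieldType.
Implicit Types (q : qform F).

(** A nonsingular form with this property is hyperbolic.  The inequality is
then an equality, but asking for no more than the inequality spares constructions a
count of dimensions. *)
Definition lagrangian q : Prop :=
  exists m (A : 'M[F]_(m, qdim q)),
    [/\ row_free A, (qdim q <= m + m)%N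
      & forall x : 'rV_m, @qeval F q (x *m A) = 0].

(** In characteristic two q2 and - q2 are the same form, so the sum below
stands for the difference of the two Witt classes. *)
Definition witt_rel q1 q2 : Prop := lagrangian (qorth q1 q2).

Lemma lagrangian_isometric q1 q2 :
  isometric q1 q2 -> lagrangian q1 -> lagrangian q2.
Proof.
move=> /isometric_mxP[B [Bf dB qB]] [m [A [Af dA qA]]].
exists m, (A *m B); split=> [||x]; last by rewrite mulmxA qB.
  by rewrite /row_free mxrankMfree.
by rewrite -dB.
Qed.

Lemma lagrangian_orth q1 q2 :
  lagrangian q1 -> lagrangian q2 -> lagrangian (qorth q1 q2).
Proof.
move=> [m [A [Af dA qA]]] [k [B [Bf dB qB]]].
exists (m + k)%N, (block_mx A 0 0 B); split=> [||x] /=.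
- apply: inj_row_free => v; rewrite -[v]hsubmxK mul_row_block !mulmx0.
  rewrite addr0 add0r -[X in _ = X]row_mx0 => /eq_row_mx[vA vB].
  rewrite -[RHS]row_mx0; congr row_mx; apply/eqP.
    by rewrite -(mulmx_free_eq0 _ Af) vA.
  by rewrite -(mulmx_free_eq0 _ Bf) vB.
- lia.
rewrite qeval_orth -{1 2}[x]hsubmxK mul_row_block !mulmx0 addr0 add0r.
by rewrite row_mxKl row_mxKr qA qB addr0.
Qed.

Lemma lagrangian_qzero : lagrangian (qzero F).
Proof.
exists 0%N, 0; split=> // [|x]; last by rewrite mulmx0 qeval0.
by rewrite /row_free mxrank0.
Qed.

Lemma block_hyperbolic_unit r (Z : 'M[F]_r) :
  block_mx 0 1%:M 1%:M Z \in unitmx.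
Proof.
rewrite -row_free_unit; apply: inj_row_free => v.
rewrite -[v]hsubmxK mul_row_block !mulmx0 !mulmx1 add0r.
rewrite -[X in _ = X]row_mx0 => /eq_row_mx[-> ].
by rewrite mul0mx addr0 => ->; rewrite row_mx0.
Qed.

(** The restriction of the polar form to the rows of W being
nondegenerate, the space is the direct sum of the span of W and its orthogonal. *)
Lemma orthogonal_complement q k (W : 'M[F]_(k, qdim q)) :
    nonsingular q -> W *m gram q *m W^T \in unitmx ->
  exists l (C : 'M[F]_(l, qdim q)),
    [/\ (l + k)%N = qdim q, row_free (col_mx C W), C *m gram q *m W^T = 0
      & nonsingular (restr C)].
Proof.
move=> /nonsingularP uG uW; set G := gram q in uG uW *.
have GWf : row_free (W *m G).
  apply: inj_row_free => v vW; have : v *m (W *m G *m W^T) = 0.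
    by rewrite mulmxA vW mul0mx.
  by move/(congr1 (mulmx^~ (invmx (W *m G *m W^T)))); rewrite mulmxK // mul0mx.
have rGW : \rank (G *m W^T) = k.
  by rewrite -mxrank_tr trmx_mul trmxK gram_sym (eqP GWf).
have [l [C [Cf]]] := kernel_basis (G *m W^T); rewrite mulmxA rGW => CW dC.
exists l, C.
have WC : W *m G *m C^T = 0.
  by apply: trmx_inj; rewrite trmx0 !trmx_mul trmxK gram_sym mulmxA CW.
have Pf : row_free (col_mx C W).
  apply: inj_row_free => v; rewrite -[v]hsubmxK mul_row_col => vP.
  have w0 : rsubmx v = 0; first have := congr1 (fun z => z *m G *m W^T) vP.
    rewrite !mulmxDl -[_ *m C *m G]mulmxA -[_ *m (C *m G) *m _]mulmxA CW mulmx0 add0r !mul0mx.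
    move/(congr1 (mulmx^~ (invmx (W *m G *m W^T)))).
    rewrite -[_ *m W *m G]mulmxA -[_ *m (W *m G) *m _]mulmxA mulmxK ?mul0mx //.
  move: vP; rewrite w0 mul0mx addr0 => /eqP.
  by rewrite (mulmx_free_eq0 _ Cf) => /eqP->; rewrite row_mx0.
split=> //; apply/nonsingularP; rewrite gram_restr -row_free_unit.
apply: inj_row_free => v vC.
have Pfull : row_full (col_mx C W).
  by rewrite -col_leq_rank (eqP Pf) /= dC.
have : v *m C *m G *m (col_mx C W)^T = 0.
  rewrite tr_col_mx mul_mx_row -[v *m C *m G]mulmxA -!(mulmxA v) CW mulmx0 vC.
  by rewrite row_mx0.
move/(congr1 (mulmx^~ (pinvmx (col_mx C W))^T)); rewrite mul0mx -mulmxA -trmx_mul.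
rewrite mulVpmx // trmx1 mulmx1 => /(congr1 (mulmx^~ (invmx G))).
rewrite mulmxK // mul0mx => /eqP.
by rewrite (mulmx_free_eq0 _ Cf) => /eqP.
Qed.

(** This is the passage from U to U^perp / U.  Choosing S
dual to U, the orthogonal of the nondegenerate space spanned by U and S is a copy
C of U^perp / U, and the vectors (u + x, x) with u in U and x in C make the sum of
q and its restriction to C metabolic. *)
Lemma totally_singular_reduction q r (U : 'M[F]_(r, qdim q)) :
    2%N \in [pchar F] -> nonsingular q -> row_free U ->
    (forall x : 'rV_r, @qeval F q (x *m U) = 0) ->
  exists q', [/\ nonsingular q', (qdim q' + (r + r))%N = qdim q
               & witt_rel q q'].
Proof.
move=> char2 nsq Uf qU; have uG := (nonsingularP q).1 nsq.
have UGf : row_free (U *m gram q).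
  by rewrite /row_free mxrankMfree // row_free_unit.
(* The rows of S are dual to those of U for the polar form. *)
pose S := (pinvmx (U *m gram q))^T.
have US : U *m gram q *m S^T = 1%:M by rewrite trmxK mulmxVp.
have SU : S *m gram q *m U^T = 1%:M.
  by apply: trmx_inj; rewrite trmx1 !trmx_mul trmxK gram_sym mulmxA US.
have uW : col_mx U S *m gram q *m (col_mx U S)^T \in unitmx.
  rewrite mul_col_mx tr_col_mx mul_col_row US SU totally_singular_polar //.
  exact: block_hyperbolic_unit.
have [l [C [dC Cf CW nsC]]] := orthogonal_complement nsq uW.
have [CU _] : C *m gram q *m U^T = 0 /\ C *m gram q *m S^T = 0.
  by move: CW; rewrite tr_col_mx mul_mx_row -[X in _ = X]row_mx0 => /eq_row_mx.
exists (restr C); split=> //; exists (l + r)%N.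
exists (block_mx C 1%:M U 0); split=> [||x] /=; last 1 first.
- rewrite qeval_orth -{1 2}[x]hsubmxK mul_row_block mulmx1 mulmx0 addr0.
  rewrite row_mxKl row_mxKr qeval_restr qevalD qU addr0 polarE trmx_mul.
  rewrite -!mulmxA [C *m _]mulmxA [_ *m (U^T *m _)]mulmxA CU mul0mx mulmx0.
  by rewrite [(0 : 'M_1) _ _]mxE addr0 addrr_pchar2.
- apply: inj_row_free => v; rewrite -[v]hsubmxK mul_row_block mulmx1 mulmx0 addr0.
  rewrite -[X in _ = X]row_mx0 => /eq_row_mx[vCU v0]; move: vCU.
  rewrite v0 mul0mx add0r => /eqP; rewrite (mulmx_free_eq0 _ Uf) => /eqP->.
  by rewrite row_mx0.
- lia.
Qed.

End Lagrangian.

(** * Witt equivalence in characteristic two *)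

Section WittEquivalence.
Variable F : fieldType.
Hypothesis char2 : 2%N \in [pchar F].
Implicit Types (q : qform F).

Lemma qeval_qbin (u v : F) (x : 'rV_(1 + 1)) :
  @qeval F (qbin u v) x =
    u * x 0 0 ^+ 2 + x 0 0 * x 0 (rshift 1 0) + v * x 0 (rshift 1 0) ^+ 2.
Proof.
have E (s : F) (y z : 'rV[F]_1) : (y *m s%:M *m z^T) 0 0 = y 0 0 * s * z 0 0.
  by rewrite mul_mx_scalar -scalemxAl !mxE big_ord1 !mxE mulrCA mulrA.
rewrite /qeval /= -{1 2}[x]hsubmxK tr_row_mx mul_row_block mul_row_col.
rewrite mulmx0 addr0 !mulmxDl !mxE.
have /= := E u (lsubmx x) (lsubmx x); rewrite mxE => ->.
have /= := E 1 (lsubmx x) (rsubmx x); rewrite mxE => ->.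
have /= := E v (rsubmx x) (rsubmx x); rewrite mxE => ->.
rewrite !mxE (_ : lshift 1 0 = 0); last exact: val_inj.
ring.
Qed.

Lemma addrr2 (x : F) : x + x = 0.
Proof. exact: addrr_pchar2. Qed.

Lemma eq_of_add0 (x y : F) : x + y = 0 -> x = y.
Proof. by move/eqP; rewrite addr_eq0 oppr_pchar2 // => /eqP. Qed.

(** This lets a ring identity be proved in characteristic two: the
multiple of 2 by which the two sides differ is supplied as t. *)
Lemma eq_mod2 (t x y : F) : x = y + 2%:R * t -> x = y.
Proof. by rewrite (pcharf0 char2) mul0r addr0. Qed.

Lemma polar_diag q x : @polar F q x x = 0.
Proof.
have -> : polar x x = 2%:R * qeval x.
  have := @qevalZ _ q 2%:R x; rewrite scaler_nat mulr2n /polar => ->.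
  by ring.
by rewrite (pcharf0 char2) mul0r.
Qed.

Lemma nonsingular_qbin (u v : F) : nonsingular (qbin u v).
Proof.
apply/nonsingularP; rewrite /gram /= tr_block_mx add_block_mx !tr_scalar_mx.
rewrite trmx0 addr0 add0r -!raddfD /= !addrr2 raddf0.
exact: block_hyperbolic_unit.
Qed.

(** If q(x) = 0 and b(x, z) = 1, then z + q(z) x is again
dual to x and singular. *)
Lemma split_hyperbolic_plane q :
    nonsingular q -> ~ anisotropic q ->
  exists2 q', nonsingular q' & isometric q (qorth q' (qbin 0 0)).
Proof.
move=> nsq nan.
have [x qx0 x0] : exists2 x, @qeval F q x = 0 & x <> 0.
  apply: NNPP => H; apply: nan => x qx0.
  by apply: NNPP => x0; apply: H; exists x.
have [y xy0] : exists y, @polar F q x y <> 0.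
  apply: NNPP => H; apply: x0; apply: nsq => y.
  by apply: NNPP => xy0; apply: H; exists y.
pose z := (polar x y)^-1 *: y.
have xz : polar x z = 1 by rewrite polarZr mulVf //; apply/eqP.
pose y' := z + qeval z *: x.
have xy' : polar x y' = 1 by rewrite polarDr polarZr polar_diag mulr0 addr0.
have qy' : qeval y' = 0.
  rewrite qevalD qevalZ qx0 mulr0 addr0 polarZr polarC xz mulr1; exact: addrr2.
pose W := col_mx x y'.
have eW (t : 'rV_(1 + 1)) : t *m W = t 0 0 *: x + t 0 (rshift 1 0) *: y'.
  rewrite -[t in LHS]hsubmxK mul_row_col [lsubmx t]mx11_scalar.
  rewrite [rsubmx t]mx11_scalar !mul_scalar_mx !mxE (_ : lshift 1 0 = 0) //.
  exact: val_inj.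
have M11 (u v : 'rV_(qdim q)) : u *m gram q *m v^T = (polar u v)%:M.
  by rewrite polarE -mx11_scalar.
have uW : W *m gram q *m W^T \in unitmx.
  rewrite mul_col_mx tr_col_mx mul_col_row !M11 (polarC y') xy' polar_diag.
  by rewrite raddf0; apply: block_hyperbolic_unit.
have [l [C [dC Cf CW nsC]]] := orthogonal_complement nsq uW.
exists (restr C) => //; apply: isometric_sym.
apply: (@isometric_mx _ (qorth (restr C) (qbin 0 0)) q (col_mx C W)) => //=.
  by rewrite dC.
move=> t; rewrite qeval_orth -{1}[t]hsubmxK mul_row_col qevalD polarE trmx_mul.
rewrite -!mulmxA [gram q *m _]mulmxA [C *m _]mulmxA [C *m _]mulmxA CW mul0mx.
rewrite mulmx0 [(0 : 'M_1) _ _]mxE addr0 qeval_restr; congr (_ + _).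
rewrite eW qevalD !qevalZ qx0 qy' polarZl polarZr xy' qeval_qbin; ring.
Qed.

Lemma hyperbolic_lagrangian m : lagrangian (hyperbolic F m).
Proof.
elim: m => [|m IHm] /=; first exact: lagrangian_qzero.
apply: lagrangian_orth => //; exists 1%N, (row_mx 1%:M 0); split=> // [|x].
  apply: inj_row_free => v.
  by rewrite mul_mx_row mulmx1 => /(congr1 lsubmx); rewrite row_mxKl linear0.
rewrite mul_mx_row mulmx1 mulmx0 qeval_qbin.
by rewrite row_mxEr [(0 : 'M_1) _ _]mxE !(mul0r, mulr0, addr0).
Qed.

Lemma anisotropic_part_exists q :
  nonsingular q -> exists phi, anisotropic_part q phi.
Proof.
have [n] := ubnP (qdim q); elim: n q => // n IHn q /ltnSE le_n nsq.
have [an | nan] := classic (anisotropic q).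
  exists q; split=> //; exists 0%N; exact: isometric_sym (isometric_orth0 q).
have [q' ns' iso] := split_hyperbolic_plane nsq nan.
have [|//|phi [an [m isom]]] := IHn q'.
  by move: le_n; rewrite (isometric_dim iso) /=; lia.
exists phi; split=> //; exists m.+1; apply: isometric_trans iso _.
apply: isometric_trans (isometric_orthC _ _) _.
apply: isometric_trans (isometric_orth (isometric_refl _) isom) _.
apply: isometric_trans (isometric_orthA _ _ _) _.
apply: isometric_trans (isometric_orth (isometric_orthC _ _)
                         (isometric_refl _)) _.
exact: isometric_sym (isometric_orthA _ _ _).
Qed.

Lemma witt_rel_sym q1 q2 : witt_rel q1 q2 -> witt_rel q2 q1.
Proof. exact: lagrangian_isometric (isometric_orthC _ _). Qed.

Lemma isometric_witt_rel q1 q2 : isometric q1 q2 -> witt_rel q1 q2.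
Proof.
move=> /isometric_mxP[A [Af dA qA]].
exists (qdim q1), (row_mx 1%:M A); split=> [||x] /=.
- apply: inj_row_free => v.
  by rewrite mul_mx_row mulmx1 => /(congr1 lsubmx); rewrite row_mxKl linear0.
- by rewrite dA.
by rewrite qeval_orth mul_mx_row mulmx1 row_mxKl row_mxKr qA; apply: addrr2.
Qed.

Lemma witt_rel_add_lagrangian q h : lagrangian h -> witt_rel q (qorth q h).
Proof.
move=> lag_h; apply: (lagrangian_isometric (isometric_sym (isometric_orthA _ _ _))).
by apply: lagrangian_orth => //; apply: isometric_witt_rel (isometric_refl _).
Qed.

(** Totally singular subspaces L of the sum of q1 and q2 and L' of
the sum of q2 and q3 are composed as relations.  The composite is the image of the
space K of pairs in L x L' with the same component in V2; the kernel I of K -> V1 + V3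
embeds in V2 and is orthogonal there to the projections of both L and L'.  As q2
is nonsingular, the rank of I and that of these projections add up to at most
dim V2, which is what the dimension count needs. *)
Lemma witt_rel_trans q2 q1 q3 :
  nonsingular q2 -> witt_rel q1 q2 -> witt_rel q2 q3 -> witt_rel q1 q3.
Proof.
move=> /nonsingularP uG [m [L [Lf dL qL]]] [m' [L' [Lf' dL' qL']]].
move: L Lf dL qL L' Lf' dL' qL' => /= L Lf dL qL L' Lf' dL' qL'.
pose A := lsubmx L; pose B := rsubmx L; pose C := lsubmx L'; pose D := rsubmx L'.
have LE : L = row_mx A B by rewrite hsubmxK.
have LE' : L' = row_mx C D by rewrite hsubmxK.
have AB x : @qeval F q1 (x *m A) = @qeval F q2 (x *m B).
  have := qL x; rewrite qeval_orth LE mul_mx_row row_mxKl row_mxKr.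
  exact: eq_of_add0.
have CD x : @qeval F q2 (x *m C) = @qeval F q3 (x *m D).
  have := qL' x; rewrite qeval_orth LE' mul_mx_row row_mxKl row_mxKr.
  exact: eq_of_add0.
have pAB : A *m gram q1 *m A^T + B *m gram q2 *m B^T = 0.
  have := totally_singular_polar qL; rewrite gram_orth LE mul_row_block.
  by rewrite !mulmx0 addr0 add0r tr_row_mx mul_row_col.
have pCD : C *m gram q2 *m C^T + D *m gram q3 *m D^T = 0.
  have := totally_singular_polar qL'; rewrite gram_orth LE' mul_row_block.
  by rewrite !mulmx0 addr0 add0r tr_row_mx mul_row_col.
(* Its kernel is the space of pairs with the same component in V2. *)
pose BC := col_mx B (- C).
have [k [Kb [Kf KBC rK]]] := kernel_basis BC.
pose X := lsubmx Kb; pose Y := rsubmx Kb.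
have KE : Kb = row_mx X Y by rewrite hsubmxK.
have XBYC : X *m B = Y *m C.
  move: KBC; rewrite KE mul_row_col mulmxN => /eqP.
  by rewrite subr_eq0 => /eqP.
pose M := row_mx (X *m A) (Y *m D).
have [l [N [Nf NM rN]]] := kernel_basis M.
have [NXA NYD] : N *m (X *m A) = 0 /\ N *m (Y *m D) = 0.
  by move: NM; rewrite mul_mx_row -[X in _ = X]row_mx0 => /eq_row_mx.
pose I := N *m X *m B.
have NXB : I = N *m Y *m C by rewrite /I -!mulmxA XBYC.
have If : row_free I.
  apply: inj_row_free => v vI; apply/eqP; rewrite -(mulmx_free_eq0 _ Nf).
  rewrite -(mulmx_free_eq0 _ Kf) KE mul_mx_row; apply/eqP.
  have -> : v *m N *m X = 0.
    apply/eqP; rewrite -(mulmx_free_eq0 _ Lf) LE mul_mx_row.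
    by rewrite -!mulmxA NXA mulmx0 [N *m _]mulmxA vI row_mx0.
  have -> : v *m N *m Y = 0.
    apply/eqP; rewrite -(mulmx_free_eq0 _ Lf') LE' mul_mx_row.
    by rewrite -!mulmxA NYD mulmx0 -XBYC [N *m _]mulmxA vI row_mx0.
  by rewrite row_mx0.
have IBC : I *m gram q2 *m BC^T = 0.
  rewrite tr_col_mx mul_mx_row linearN /= mulmxN.
  have -> : I *m gram q2 *m B^T = 0.
    have := congr1 (fun Z => N *m X *m Z) pAB; rewrite mulmx0 mulmxDr !mulmxA.
    by rewrite -[_ *m X *m A]mulmxA NXA !mul0mx add0r.
  have -> : I *m gram q2 *m C^T = 0.
    have := congr1 (fun Z => N *m Y *m Z) pCD; rewrite mulmx0 mulmxDr !mulmxA.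
    by rewrite -[_ *m Y *m D]mulmxA NYD !mul0mx addr0 NXB.
  by rewrite oppr0 row_mx0.
have rI : (l + \rank BC <= qdim q2)%N.
  have := mulmx0_rank_max IBC; rewrite mxrank_tr mxrankMfree ?row_free_unit //.
  by rewrite (eqP If).
exists (\rank M), (row_base M); split=> [||x] /=; first exact: row_base_free.
  by move: dL dL' rI rK rN; lia.
have /submxP[Z ->] : (row_base M <= M)%MS by rewrite eq_row_base.
rewrite qeval_orth !mul_mx_row row_mxKl row_mxKr !mulmxA AB -CD.
by rewrite -(mulmxA _ X) -(mulmxA _ Y) XBYC; apply: addrr2.
Qed.

(** A totally singular subspace meets neither
summand, so it projects injectively to both; by its dimension it is the graph of a
bijection, and this is an isometry. *)
Lemma anisotropic_witt_rel_isometric q1 q2 :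
  anisotropic q1 -> anisotropic q2 -> witt_rel q1 q2 -> isometric q1 q2.
Proof.
move=> an1 an2 [m [L [Lf dL qL]]].
move: L Lf dL qL => /= L Lf dL qL.
pose A := lsubmx L; pose B := rsubmx L.
have LE : L = row_mx A B by rewrite hsubmxK.
have AB x : @qeval F q1 (x *m A) = @qeval F q2 (x *m B).
  have := qL x; rewrite qeval_orth LE mul_mx_row row_mxKl row_mxKr.
  exact: eq_of_add0.
have Af : row_free A.
  apply: inj_row_free => v vA; apply/eqP; rewrite -(mulmx_free_eq0 _ Lf) LE.
  by rewrite mul_mx_row vA (an2 (v *m B)) ?row_mx0 // -AB vA qeval0.
have Bf : row_free B.
  apply: inj_row_free => v vB; apply/eqP; rewrite -(mulmx_free_eq0 _ Lf) LE.
  by rewrite mul_mx_row vB (an1 (v *m A)) ?row_mx0 // AB vB qeval0.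
have le1 := rank_leq_col A; have le2 := rank_leq_col B.
move: le1 le2; rewrite (eqP Af) (eqP Bf) => le1 le2.
have Afull : row_full A by rewrite -col_leq_rank (eqP Af); lia.
apply: (@isometric_mx _ _ _ (pinvmx A *m B)); last 2 first.
- lia.
- by move=> x; rewrite mulmxA -AB -mulmxA mulVpmx // mulmx1.
by rewrite /row_free mxrankMfree //; have := pinvmx_free Afull.
Qed.

Lemma witt_equivP q1 q2 : nonsingular q1 -> nonsingular q2 ->
  witt_equiv q1 q2 <-> witt_rel q1 q2.
Proof.
move=> ns1 ns2; split=> [|rel12].
  case=> phi1 [phi2 [[an1 [m iso1]] [an2 [k iso2]] iso]].
  have nsh1 := nonsingular_isometric iso1 ns1.
  have nsh2 := nonsingular_isometric iso2 ns2.
  have [nsp1 _] := (nonsingular_orth _ _).1 nsh1.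
  have [nsp2 _] := (nonsingular_orth _ _).1 nsh2.
  apply: (witt_rel_trans nsh1 (isometric_witt_rel iso1)).
  apply: (witt_rel_trans nsp1).
    exact: witt_rel_sym (witt_rel_add_lagrangian _ (hyperbolic_lagrangian _)).
  apply: (witt_rel_trans nsp2 (isometric_witt_rel iso)).
  apply: (witt_rel_trans nsh2).
    exact: witt_rel_add_lagrangian (hyperbolic_lagrangian _).
  exact: witt_rel_sym (isometric_witt_rel iso2).
have [phi1 [an1 [m iso1]]] := anisotropic_part_exists ns1.
have [phi2 [an2 [k iso2]]] := anisotropic_part_exists ns2.
have nsh1 := nonsingular_isometric iso1 ns1.
have nsh2 := nonsingular_isometric iso2 ns2.
exists phi1, phi2; split; [by split=> //; exists m | by split=> //; exists k |].
apply: anisotropic_witt_rel_isometric => //.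
apply: (witt_rel_trans nsh1).
  exact: witt_rel_add_lagrangian (hyperbolic_lagrangian _).
apply: (witt_rel_trans ns1); first exact: witt_rel_sym (isometric_witt_rel iso1).
apply: (witt_rel_trans ns2 rel12).
apply: (witt_rel_trans nsh2 (isometric_witt_rel iso2)).
exact: witt_rel_sym (witt_rel_add_lagrangian _ (hyperbolic_lagrangian _)).
Qed.

Lemma lagrangian_witt_rel q1 q2 : nonsingular q1 ->
  witt_rel q1 q2 -> lagrangian q1 -> lagrangian q2.
Proof.
move=> ns1 rel12 lag1.
apply: (lagrangian_isometric (isometric_orth0 _)).
apply: (witt_rel_trans ns1 (witt_rel_sym rel12)).
exact: (lagrangian_isometric (isometric_sym (isometric_orth0 _))).
Qed.

Lemma witt_equiv0P q : nonsingular q -> witt_equiv q (qzero F) <-> lagrangian q.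
Proof.
move=> nsq; rewrite witt_equivP //; last by move=> x _; apply/rowP; case.
split; first exact: lagrangian_isometric (isometric_orth0 _).
exact: lagrangian_isometric (isometric_sym (isometric_orth0 _)).
Qed.

End WittEquivalence.

(** * Tensor products *)

Definition alternating (F : fieldType) n (N : 'M[F]_n) : Prop :=
  N + N^T = 0 /\ forall i, N i i = 0.

(** An alternating matrix is T - T^T for a strictly upper triangular T,
and x T x^T = x T^T x^T. *)
Lemma alternatingP (F : fieldType) n (N : 'M[F]_n) :
  alternating N <-> forall x : 'rV_n, (x *m N *m x^T) 0 0 = 0.
Proof.
split=> [[Nalt N0] x | N0].
  pose T := \matrix_(i, j) if (i < j)%N then N i j else 0.
  have -> : N = T - T^T.
    apply/matrixP => i j; rewrite !mxE.
    have Nij : N i j + N j i = 0 by have /matrixP/(_ i j) := Nalt; rewrite !mxE.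
    have [ij | ji | /val_inj ->] := ltngtP i j.
    - by rewrite subr0.
    - by rewrite sub0r; apply/eqP; rewrite -addr_eq0 Nij.
    - by rewrite subr0 N0.
  by rewrite mulmxBr mulmxBl mxE [X in _ + X]mxE -mulmx_tr11 subrr.
split=> [|i].
  (* The polar form of the quadratic form of N has matrix N + N^T. *)
  have := @totally_singular_polar _ (QForm N) n 1%:M.
  by rewrite /gram /= mul1mx trmx1 mulmx1; apply=> x; rewrite mulmx1; apply: N0.
have := N0 (delta_mx 0 i).
by rewrite -rowE trmx_delta -colE !mxE.
Qed.

Section Tensor.
Variable F : fieldType.
Implicit Types (q : qform F) (B : bform F).

Lemma lagrangianP q : lagrangian q <->
  exists m (A : 'M[F]_(m, qdim q)),
    [/\ row_free A, (qdim q <= m + m)%N & alternating (A *m qmx q *m A^T)].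
Proof.
split=> -[m [A [Af dA qA]]]; exists m, A; split=> //.
  by apply/alternatingP => x; have := qA x; rewrite /qeval trmx_mul !mulmxA.
by move=> x; have /alternatingP/(_ x) := qA; rewrite /qeval trmx_mul !mulmxA.
Qed.

Lemma tensmx11 m n : (1%:M : 'M[F]_m) *t (1%:M : 'M[F]_n) = 1%:M.
Proof.
apply/matrixP => i j; case: (mxtens_indexP i) => i0 i1.
case: (mxtens_indexP j) => j0 j1; rewrite tensmxE !mxE.
by rewrite (can_eq (@mxtens_indexK _ _)) xpair_eqE; do 2!case: eqP => //;
  rewrite ?mulr0 ?mul0r ?mulr1.
Qed.

Lemma row_free_tens m n p r (A : 'M[F]_(m, n)) (C : 'M[F]_(p, r)) :
  row_free A -> row_free C -> row_free (A *t C).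
Proof.
move=> /row_freeP[A' AA'] /row_freeP[C' CC']; apply/row_freeP.
by exists (A' *t C'); rewrite tensmx_mul AA' CC' tensmx11.
Qed.

Lemma gram_bqtens B q : (bmx B)^T = bmx B -> gram (bqtens B q) = bmx B *t gram q.
Proof.
move=> symB; rewrite /gram /= trmx_tens symB; apply/matrixP => i j.
by rewrite !mxE mulrDr.
Qed.

Lemma nonsingular_bqtens B q :
  nonsingular_symmetric B -> nonsingular q -> nonsingular (bqtens B q).
Proof.
move=> [symB uB] /nonsingularP uq; apply/nonsingularP; rewrite gram_bqtens //.
by rewrite -row_free_unit row_free_tens // row_free_unit.
Qed.

Lemma lagrangian_bqtens B q :
  (bmx B)^T = bmx B -> lagrangian q -> lagrangian (bqtens B q).
Proof.
move=> symB /lagrangianP[m [A [Af dA [Aalt A0]]]]; apply/lagrangianP.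
exists (bdim B * m)%N, (1%:M *t A); split=> [||] /=.
- by rewrite row_free_tens // row_free_unit unitmx1.
- by rewrite -mulnDr leq_mul2l dA orbT.
rewrite trmx_tens !tensmx_mul mul1mx trmx1 mulmx1; split=> [|i].
  rewrite trmx_tens symB -[RHS](tensmx0 (bmx B)) -Aalt.
  by apply/matrixP => i j; rewrite !mxE mulrDr.
by case: (mxtens_indexP i) => i0 i1; rewrite tensmxE A0 mulr0.
Qed.

(** A totally isotropic half of the bilinear factor stays
totally singular after tensoring with any quadratic form. *)
Lemma lagrangian_metabolic_tens B q m (W : 'M[F]_(m, bdim B)) :
    row_free W -> (bdim B <= m + m)%N -> W *m bmx B *m W^T = 0 ->
  lagrangian (bqtens B q).
Proof.
move=> Wf dW W0; apply/lagrangianP; exists (m * qdim q)%N, (W *t 1%:M).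
split=> [||] /=.
- by rewrite row_free_tens // row_free_unit unitmx1.
- by rewrite -mulnDl leq_mul2r dW orbT.
rewrite trmx_tens !tensmx_mul W0 tens0mx; split=> [|i]; last by rewrite mxE.
by rewrite trmx0 addr0.
Qed.

(** The inclusion of F^l as e_i (x) F^l in F^k (x) F^l. *)
Definition emb_left k l (i : 'I_k) : 'M[F]_(l, k * l) :=
  rowsub (fun j => mxtens_index (i, j)) 1%:M.

(** The inclusion of F^k as F^k (x) e_j in F^k (x) F^l. *)
Definition emb_right k l (j : 'I_l) : 'M[F]_(k, k * l) :=
  rowsub (fun i => mxtens_index (i, j)) 1%:M.

Lemma mulmx_rowsub1 m m' n (f : 'I_m -> 'I_n) (g : 'I_m' -> 'I_n) (N : 'M[F]_n) :
  rowsub f 1%:M *m N *m (rowsub g 1%:M)^T = mxsub f g N.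
Proof.
rewrite mul_rowsub_mx mul1mx trmx_mxsub trmx1 mulmx_colsub mulmx1.
by apply/matrixP => i j; rewrite !mxE.
Qed.

Lemma emb_leftE B q i i' :
  emb_left (qdim q) i *m qmx (bqtens B q) *m (emb_left (qdim q) i')^T
    = bmx B i i' *: qmx q.
Proof. by rewrite mulmx_rowsub1; apply/matrixP => j j'; rewrite mxE tensmxE mxE. Qed.

Lemma emb_rightE B q j j' :
  emb_right (bdim B) j *m qmx (bqtens B q) *m (emb_right (bdim B) j')^T
    = qmx q j j' *: bmx B.
Proof.
by rewrite mulmx_rowsub1; apply/matrixP => i i'; rewrite mxE tensmxE mxE mulrC.
Qed.

Lemma emb_left_orth k l i i' :
  emb_left l i *m (emb_left l i')^T = (i == i' :> 'I_k)%:R%:M.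
Proof.
rewrite -[emb_left l i]mulmx1 mulmx_rowsub1; apply/matrixP => j j'.
by rewrite !mxE (can_eq (@mxtens_indexK _ _)) xpair_eqE /= -mulnb natrM
  -[RHS]mulr_natr.
Qed.

End Tensor.

(** * Pfister forms *)

Section PfisterForms.
Variable F : fieldType.
Hypothesis char2 : 2%N \in [pchar F].

Lemma bpfister1E (g : F) :
  bmx (bpfister [:: g]) = diag_mx (\row_(i < 2) [:: 1; - g]`_i).
Proof.
apply/matrixP => i j; rewrite !mxE.
case: i => [[|[|i]] //= ltiP]; case: j => [[|[|j]] //= ltjP];
  by rewrite /= ?(mulr0n, mulr1n) ?(mulr0, mul0r, mulr1, mul1r).
Qed.

Lemma bpfister2E (b d : F) :
  bmx (bpfister [:: b; d]) = diag_mx (\row_(i < 4) [:: 1; - d; - b; b * d]`_i).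
Proof.
apply/matrixP => i j; rewrite !mxE.
case: i => [[|[|[|[|i]]]] //= ltiP]; case: j => [[|[|[|[|j]]]] //= ltjP];
  by rewrite /= ?(mulr0n, mulr1n) ?(mulr0, mul0r, mulr1, mul1r) ?mulrNN.
Qed.

Lemma nonsingular_symmetric_diag n (r : 'rV[F]_n) :
  (forall i, r 0 i != 0) -> nonsingular_symmetric (BForm (diag_mx r)).
Proof.
move=> r0; split; first exact: tr_diag_mx.
by rewrite unitmxE det_diag unitfE; apply/prodf_neq0.
Qed.

Lemma nonsingular_symmetric_bpfister (s : seq F) :
  all (fun a => a != 0) s -> nonsingular_symmetric (bpfister s).
Proof.
have tens (B C : bform F) : nonsingular_symmetric B -> nonsingular_symmetric C ->
    nonsingular_symmetric (btens B C).
  move=> [sB uB] [sC uC]; split; first by rewrite trmx_tens sB sC.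
  by rewrite -row_free_unit row_free_tens // row_free_unit.
elim: s => [_|a s IHs] /=.
  by apply: nonsingular_symmetric_diag => i; rewrite mxE (ord1 i) oner_eq0.
case/andP=> a0 /IHs; apply: tens; apply: nonsingular_symmetric_diag => -[i lti].
by rewrite mxE; case: i lti => [|[|//]] _ /=; rewrite ?oner_eq0 ?oppr_eq0.
Qed.

(** The vector (x, 1) is singular. *)
Lemma lagrangian_qbin (g x : F) : x ^+ 2 + x + g = 0 -> lagrangian (qbin 1 g).
Proof.
move=> xg; exists 1%N, (row_mx x%:M 1%:M); split=> // [|t].
  apply: inj_row_free => v.
  by rewrite mul_mx_row mulmx1 => /(congr1 rsubmx); rewrite row_mxKr linear0.
rewrite mul_mx_row mulmx1 mul_mx_scalar qeval_qbin row_mxEr.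
have -> : (row_mx (x *: t) t) 0 0 = x * t 0 0.
  have := row_mxEl (x *: t) t 0 0; rewrite [RHS]mxE => <-.
  by congr (row_mx _ _ _ _); apply: val_inj.
by rewrite -[RHS](mul0r (t 0 0 ^+ 2)) -xg; ring.
Qed.

(** The bilinear form <1, -x^2> vanishes at (x, 1). *)
Lemma lagrangian_qpfister_sqr (g h x : F) :
  x ^+ 2 = g -> lagrangian (qpfister [:: g] h).
Proof.
move=> xg; pose W : 'M[F]_(1, 2) := \row_j [:: x; 1]`_j.
apply: (@lagrangian_metabolic_tens _ (bpfister [:: g]) (qbin 1 h) 1 W) => //.
  apply: inj_row_free => v vW; apply/rowP => i; rewrite (ord1 i).
  by have /rowP/(_ ord_max) := vW; rewrite !mxE big_ord1 !mxE /= mulr1.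
rewrite bpfister1E mul_mx_diag; apply/matrixP => i j.
rewrite !mxE !big_ord_recl big_ord0 !mxE /= -xg; ring.
Qed.

(** Let N = [1, h] be the norm form of the algebra
F[theta] with theta^2 = theta + h.  If g = N(z), then by multiplicativity the
vectors (z y, y) are singular for the sum of N and - g N. *)
Lemma lagrangian_qpfister_norm (g h z1 z2 : F) :
  z1 ^+ 2 + z1 * z2 + h * z2 ^+ 2 = g -> lagrangian (qpfister [:: g] h).
Proof.
move=> zg; (* The matrix of multiplication by z1 + z2 theta in the basis 1, theta. *)
pose Z : 'M[F]_(1 + 1) := block_mx z1%:M z2%:M (h * z2)%:M (z1 + z2)%:M.
have ZE (x : 'rV[F]_(1 + 1)) :
    @qeval F (qbin 1 h) (x *m Z) = g * @qeval F (qbin 1 h) x.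
  rewrite -[x]hsubmxK mul_row_block !mul_mx_scalar !qeval_qbin !row_mxEr.
  have row0 (u v : 'rV[F]_1) : (row_mx u v) 0 0 = u 0 0.
    have := row_mxEl u v 0 0 => <-.
    by congr (row_mx _ _ _ _); apply: val_inj.
  rewrite !row0 !mxE -zg; apply: (eq_mod2 char2 (t := x 0 (rshift 1 0) ^+ 2 * (h * z1 * z2 + h * z2 ^+ 2)
    + x 0 (lshift 1 0) * x 0 (rshift 1 0) * (2%:R * h * z1 * z2 + h * z2 ^+ 2))).
  ring.
pose i0 : 'I_(2 * 1) := Ordinal (isT : 0 < 2 * 1)%N.
pose i1 : 'I_(2 * 1) := Ordinal (isT : 1 < 2 * 1)%N.
pose L := Z *m emb_left F 2 i0 + emb_left F 2 i1.
have L1 : L *m (emb_left F 2 i1)^T = 1%:M.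
  by rewrite mulmxDl -mulmxA !emb_left_orth /= raddf0 mulmx0 add0r.
apply/lagrangianP; exists 2%N, L; split=> //.
  by apply/row_freeP; exists (emb_left F 2 i1)^T.
have D00 : bmx (bpfister [:: g]) i0 i0 = 1 by rewrite bpfister1E !mxE.
have D01 : bmx (bpfister [:: g]) i0 i1 = 0 by rewrite bpfister1E !mxE.
have D10 : bmx (bpfister [:: g]) i1 i0 = 0 by rewrite bpfister1E !mxE.
have D11 : bmx (bpfister [:: g]) i1 i1 = - g by rewrite bpfister1E !mxE.
have E := @emb_leftE F (bpfister [:: g]) (qbin 1 h).
have -> : L *m qmx (qpfister [:: g] h) *m L^T
    = Z *m qmx (qbin 1 h) *m Z^T - g *: qmx (qbin 1 h).
  rewrite /L linearD /= trmx_mul mulmxDl mulmxDr !mulmxDl !mulmxA.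
  set K0 := emb_left _ _ i0; set K1 := emb_left _ _ i1; set G := _ *t _.
  rewrite -[Z *m K0 *m G]mulmxA -[Z *m (K0 *m G) *m K0^T]mulmxA.
  rewrite -[Z *m (K0 *m G) *m K1^T]mulmxA !E D00 D01 D10 D11.
  by rewrite !scale0r scale1r mulmx0 mul0mx !addr0 add0r scaleNr.
apply/alternatingP => x; rewrite mulmxBr mulmxBl -scalemxAr -scalemxAl mxE.
rewrite [X in _ + X]mxE [X in _ - X]mxE; have := ZE x.
by rewrite /qeval trmx_mul !mulmxA => ->; rewrite subrr.
Qed.

(** In the basis 1, sqrt b, sqrt d, sqrt bd of the symbol
algebra, x^2 + x sqrt b + sqrt d has square x^4 + b x^2 + d = 0; this element and
its product with sqrt b span a totally isotropic plane of the bilinear form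
<1, -b, -d, bd>. *)
Lemma lagrangian_qpfister2 (b d h x : F) :
  x ^+ 4 + b * x ^+ 2 + d = 0 -> lagrangian (qpfister [:: b; d] h).
Proof.
move=> xbd.
pose W : 'M[F]_(2, 4) := \matrix_(i, j)
  (nth [::] [:: [:: x ^+ 2; 1; x; 0]; [:: x * b; 0; x ^+ 2; 1]] i)`_j.
apply: (@lagrangian_metabolic_tens _ (bpfister [:: b; d]) (qbin 1 h) 2 W) => //.
  apply: inj_row_free => v vW; apply/rowP => i.
  have /rowP/(_ (inord 1)) := vW; have /rowP/(_ (inord 3)) := vW.
  rewrite !mxE !big_ord_recl !big_ord0 !mxE !inordK //= !(mulr0, mulr1, addr0, add0r).
  move=> v1 v0; case: i => [[|[|//]] lti].
    by rewrite -[RHS]v0; congr (v _ _); apply: val_inj.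
  by rewrite -[RHS]v1; congr (v _ _); apply: val_inj.
rewrite bpfister2E mul_mx_diag; apply/matrixP => i j.
have dE : d = x ^+ 4 + b * x ^+ 2 by apply/esym/(eq_of_add0 char2); rewrite -xbd.
rewrite !mxE !big_ord_recl big_ord0 !mxE /= dE.
case: i => [[|[|//]] lti]; case: j => [[|[|//]] ltj] /=.
- by apply: (eq_mod2 char2 (t := - b * x ^+ 2)); ring.
- by ring.
- by ring.
- by apply: (eq_mod2 char2 (t := b ^+ 2 * x ^+ 2)); ring.
Qed.

End PfisterForms.

(** * Scalar extension *)

Section ScalarExtension.
Variables (F : fieldType) (E : fieldExtType F).
Implicit Types (q : qform F) (B : bform F).

Definition bext B : bform E := BForm (map_mx (in_alg E) (bmx B)).

Lemma qext_orth q1 q2 : qext E (qorth q1 q2) = qorth (qext E q1) (qext E q2).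
Proof. by rewrite /qext /qorth /= map_block_mx !map_mx0. Qed.

Lemma qext_bqtens B q : qext E (bqtens B q) = bqtens (bext B) (qext E q).
Proof. by rewrite /qext /bqtens /= map_mxT. Qed.

Lemma qext_qbin (u v : F) : qext E (qbin u v) = qbin u%:A v%:A.
Proof. by rewrite /qext /qbin /= map_block_mx !map_scalar_mx map_mx0 /= scale1r. Qed.

Lemma bext_bpfister (s : seq F) :
  bext (bpfister s) = bpfister [seq in_alg E x | x <- s].
Proof.
have bext_bdiag a :
    map_mx (in_alg E) (bmx (bdiag [:: 1; - a])) = bmx (bdiag [:: 1; - a%:A]).
  apply/matrixP => i j; rewrite !mxE raddfMn /=.
  by case: i => [[|[|//]] lti] /=; rewrite ?scale1r ?scaleNr.
elim: s => [|a s IHs] /=.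
  rewrite /bext /bdiag /=; congr BForm; apply/matrixP => i j.
  by rewrite !mxE raddfMn (ord1 i) /= scale1r.
rewrite -IHs /bext /btens /= map_mxT.
exact: (congr1 (fun M : 'M[E]_2 => BForm (M *t _)) (bext_bdiag a)).
Qed.

Lemma qext_qpfister (s : seq F) h :
  qext E (qpfister s h) = qpfister [seq in_alg E x | x <- s] h%:A.
Proof. by rewrite /qpfister qext_bqtens bext_bpfister qext_qbin scale1r. Qed.

Lemma nonsingular_qext q : nonsingular q -> nonsingular (qext E q).
Proof.
move=> /nonsingularP uq; apply/nonsingularP.
by rewrite /gram /= map_trmx -map_mxD map_unitmx.
Qed.

Lemma lagrangian_qext q : lagrangian q -> lagrangian (qext E q).
Proof.
move=> /lagrangianP[m [A [Af dA [Aalt A0]]]]; apply/lagrangianP.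
exists m, (map_mx (in_alg E) A); split; rewrite ?row_free_map //=.
rewrite map_trmx -!map_mxM; split=> [|i]; last by rewrite mxE A0 rmorph0.
by rewrite map_trmx -map_mxD Aalt map_mx0.
Qed.

Lemma witt_rel_qext q1 q2 :
  witt_rel q1 q2 -> witt_rel (qext E q1) (qext E q2).
Proof. by move/lagrangian_qext; rewrite qext_orth. Qed.

Lemma qeval_qext q (x : 'rV_(qdim q)) :
  @qeval E (qext E q) (map_mx (in_alg E) x) = (qeval x)%:A.
Proof. by rewrite /qeval /= map_trmx -!map_mxM mxE. Qed.

Lemma polar_qext q (x y : 'rV_(qdim q)) :
  @polar E (qext E q) (map_mx (in_alg E) x) (map_mx (in_alg E) y) = (polar x y)%:A.
Proof.
by rewrite /polar -map_mxD !qeval_qext !scalerBl.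
Qed.

End ScalarExtension.

(** * Isotropic vectors over the quartic extension *)

Section QuarticExtension.
Variables (F : fieldType) (E : fieldExtType F) (alpha : E).
Hypothesis degE : \dim {:E} = 4%N.
Hypothesis free_alpha : forall u0 u1 u2 u3 : F,
  u0%:A + u1%:A * alpha + u2%:A * alpha ^+ 2 + u3%:A * alpha ^+ 3 = 0 ->
  [/\ u0 = 0, u1 = 0, u2 = 0 & u3 = 0].
Implicit Types (q : qform F).

Local Notation iota := (map_mx (in_alg E)).

(** A linear condition over E on a vector defined over F is
four linear conditions over F. *)
Lemma restriction_of_scalars m p (A : 'M[E]_(m, p)) :
  exists A' : 'M[F]_(m, p * 4), forall v : 'rV_m, v *m A' = 0 -> iota v *m A = 0.
Proof.
rewrite -degE.
exists (\matrix_(i, k) coord (vbasis {:E}) (mxtens_unindex k).2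
                         (A i (mxtens_unindex k).1)) => v v0.
apply/rowP => j; rewrite !mxE [LHS](coord_vbasis (memvf _)).
apply: big1 => l _; rewrite linear_sum /=.
have /rowP/(_ (mxtens_index (j, l))) := v0; rewrite !mxE => vA.
suff -> : \sum_i coord (vbasis {:E}) l (iota v 0 i * A i j) = 0.
  by rewrite scale0r.
rewrite -[RHS]vA; apply: eq_bigr => i _.
by rewrite !mxE mxtens_indexK mulr_algl linearZ.
Qed.

(** The heart of the proof.  Vectors of V_E of the form
x alpha^2 + y alpha + z are parametrized by F^(3n); to lie in a totally singular
subspace L with 2 dim L >= n is at most 2n conditions over F.  So at least n
parameters remain, and x determines y and z, because the vectors with x = 0 vanish
by anisotropy. *)
Lemma isotropic_quadratic_sections q :
    anisotropic q -> lagrangian (qext E q) ->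
  exists P R : 'M[F]_(qdim q), forall x : 'rV_(qdim q),
    @qeval E (qext E q)
      (alpha ^+ 2 *: iota x + (alpha *: iota (x *m P) + iota (x *m R))) = 0.
Proof.
move=> an [m [L [Lf dL qL]]]; set n := qdim q.
rewrite -/n in Lf dL.
(* The columns of K are linear equations for L. *)
have [p [K [LK dK]]] : exists p (K : 'M[E]_(n, p)),
    (forall u : 'rV_n, u *m K = 0 -> (u <= L)%MS) /\ (p + m)%N = n.
  exists _, (col_base (cokermx L)); split=> [u uK|].
    by rewrite submxE -(mulmx_base (cokermx L)) mulmxA uK mul0mx.
  by rewrite mxrank_coker (eqP Lf) subnK // -(eqP Lf) rank_leq_col.
have qK (u : 'rV_n) : u *m K = 0 -> @qeval E (qext E q) u = 0.
  by move/LK/submxP => [z ->]; apply: qL.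
have [A AE] := restriction_of_scalars
  (col_mx (alpha ^+ 2 *: K) (col_mx (alpha *: K) K)).
have qA (v : 'rV_(n + (n + n))) : v *m A = 0 ->
    @qeval E (qext E q) (alpha ^+ 2 *: iota (lsubmx v)
      + (alpha *: iota (lsubmx (rsubmx v)) + iota (rsubmx (rsubmx v)))) = 0.
  move/AE => vA; apply: qK; rewrite !mulmxDl -!scalemxAl -[RHS]vA.
  rewrite -{4}[v]hsubmxK map_row_mx mul_row_col -scalemxAr; congr (_ + _).
  rewrite -{3}[rsubmx v]hsubmxK map_row_mx mul_row_col -scalemxAr.
  by [].
have [r [Kb [Kf KA dr]]] := kernel_basis A.
(* The component x of the solutions (x, y, z). *)
pose V := lsubmx Kb.
have Vf : row_free V.
  apply: inj_row_free => v vV; apply/eqP; rewrite -(mulmx_free_eq0 _ Kf).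
  have := qA (v *m Kb); rewrite -mulmxA KA mulmx0 => /(_ erefl).
  rewrite -[v *m Kb]hsubmxK; set w := v *m Kb.
  have -> : lsubmx w = 0 by rewrite -vV /V /w -mulmx_lsub.
  rewrite !(row_mxKl, row_mxKr) map_mx0 scaler0 add0r qevalD qevalZ.
  rewrite polarZl !qeval_qext polar_qext => H.
  set w1 := lsubmx (rsubmx w) in H *; set w0 := rsubmx (rsubmx w) in H *.
  have [|q0 _ q1 _] := @free_alpha (qeval w0) (polar w1 w0) (qeval w1) 0.
    by rewrite -[RHS]H scale0r; ring.
  by rewrite -[rsubmx w]hsubmxK -/w1 -/w0 (an _ q0) (an _ q1) !row_mx0.
have Vfull : row_full V.
  rewrite -col_leq_rank (eqP Vf); have := rank_leq_col A; lia.
pose S := pinvmx V; have SV : S *m V = 1%:M by rewrite mulVpmx.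
exists (S *m lsubmx (rsubmx Kb)), (S *m rsubmx (rsubmx Kb)) => x.
have := qA (x *m S *m Kb); rewrite -[_ *m A]mulmxA KA mulmx0 => /(_ erefl).
rewrite -!mulmx_rsub -!mulmx_lsub -/V -[x *m S *m V]mulmxA SV mulmx1.
by rewrite !mulmxA.
Qed.

Variables a b c d : F.
Hypothesis quartic_alpha :
  alpha ^+ 4 + a%:A * alpha ^+ 3 + b%:A * alpha ^+ 2 + c%:A * alpha + d%:A = 0.

(** These are the coefficients of 1, alpha, alpha^2, alpha^3 after
reduction by the minimal polynomial. *)
Lemma section_identities q (P R : 'M[F]_(qdim q)) :
    (forall x : 'rV_(qdim q),
      @qeval E (qext E q)
       (alpha ^+ 2 *: iota x + (alpha *: iota (x *m P) + iota (x *m R))) = 0) ->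
  forall x : 'rV_(qdim q),
    [/\ polar x (x *m P) = a * qeval x,
        polar x (x *m R) + qeval (x *m P) = b * qeval x,
        polar (x *m P) (x *m R) = c * qeval x
      & qeval (x *m R) = d * qeval x].
Proof.
move=> qPR x; have := qPR x; rewrite !qevalD !qevalZ polarDr !polarZl !polarZr.
rewrite !qeval_qext !polar_qext => H.
have [|d0 c0 b0 a0] := @free_alpha (qeval (x *m R) - d * qeval x)
    (polar (x *m P) (x *m R) - c * qeval x)
    (polar x (x *m R) + qeval (x *m P) - b * qeval x)
    (polar x (x *m P) - a * qeval x).
  have comb (u v w s : E) : v = 0 -> w = 0 -> u = v - s * w -> u = 0.
    by move=> -> -> ->; rewrite mulr0 subr0.
  apply: (comb _ _ _ (qeval x)%:A H quartic_alpha).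
  rewrite -!in_algE !(rmorphB, rmorphD, rmorphM) /=; ring.
by split; apply/eqP; rewrite -subr_eq0 ?d0 ?c0 ?b0 ?a0.
Qed.

End QuarticExtension.

(** * Common subforms *)

Section Overlap.
Variable F : fieldType.
Hypothesis char2 : 2%N \in [pchar F].
Implicit Types (q : qform F) (B : bform F).

(** The forms q and s gamma have isometric restrictions to the subspaces
spanned by X and Y; the dimension of this common part is more than half of
dim gamma. *)
Definition overlap q gamma (s : F) : Prop :=
  exists r (X : 'M[F]_(r, qdim q)) (Y : 'M[F]_(r, qdim gamma)),
    [/\ row_free X, (qdim gamma < r + r)%N
      & forall x : 'rV_r, @qeval F q (x *m X) = s * @qeval F gamma (x *m Y)].

Lemma diag_form k (D x : 'rV[F]_k) :
  (x *m diag_mx D *m x^T) 0 0 = \sum_i D 0 i * x 0 i ^+ 2.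
Proof.
by rewrite mul_mx_diag mxE; apply: eq_bigr => i _; rewrite !mxE expr2 mulrAC mulrC.
Qed.

Lemma polarM q k l (A : 'M[F]_(k, qdim q)) (C : 'M[F]_(l, qdim q)) y z :
  @polar F q (y *m A) (z *m C) = (y *m (A *m gram q *m C^T) *m z^T) 0 0.
Proof. by rewrite polarE trmx_mul !mulmxA. Qed.

Lemma rows_entry q k (Z : 'M[F]_(k, qdim q)) (M : 'M[F]_(qdim q)) i j :
  (Z *m M *m Z^T) i j = (row i Z *m M *m (row j Z)^T) 0 0.
Proof. by rewrite !rowE trmx_mul trmx_delta !mulmxA -colE -!mulmxA -rowE !mxE. Qed.

Lemma gram_orthogonal_rows q k (Z : 'M[F]_(k, qdim q)) :
    (forall i j : 'I_k, (i < j)%N -> @polar F q (row i Z) (row j Z) = 0) ->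
  Z *m gram q *m Z^T = 0.
Proof.
move=> oZ; apply/matrixP => i j; rewrite rows_entry -polarE mxE.
have [ij | ji | /val_inj ->] := ltngtP i j; first exact: oZ.
  by rewrite polarC oZ.
exact: polar_diag.
Qed.

Lemma qeval_orthogonal_rows q k (Z : 'M[F]_(k, qdim q)) (D : 'rV[F]_k) s :
    (forall i, @qeval F q (row i Z) = s * D 0 i) ->
    (forall i j : 'I_k, (i < j)%N -> @polar F q (row i Z) (row j Z) = 0) ->
  forall x : 'rV_k,
    @qeval F q (x *m Z) = s * (x *m diag_mx D *m x^T) 0 0.
Proof.
move=> qZ oZ x; pose N := Z *m qmx q *m Z^T - s *: diag_mx D.
have /alternatingP/(_ x) : alternating N.
  split=> [|i].
    rewrite linearB linearZ /= tr_diag_mx !trmx_mul trmxK addrACA -opprD.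
    have -> : s *: diag_mx D + s *: diag_mx D = 0.
      by apply/matrixP => i j; rewrite !mxE; apply: addrr2.
    by rewrite subr0 mulmxA -mulmxDl -mulmxDr gram_orthogonal_rows.
  have Nii := rows_entry Z (qmx q) i i; rewrite -/(qeval _) qZ in Nii.
  by rewrite mxE Nii !mxE eqxx mulr1n subrr.
rewrite mulmxBr mulmxBl -scalemxAr -scalemxAl mxE [X in _ + X]mxE.
rewrite [X in _ - X]mxE => /eqP; rewrite subr_eq0 => /eqP <-.
by rewrite /qeval trmx_mul !mulmxA.
Qed.

(** Here B = <D>, and D_i0 = 1.  In the form s B (x) [1, h] the
vectors e_i (x) (1, 0) and e_i0 (x) (0, 1) satisfy the relations required of the
rows of Z and of u.  They span a subspace of dimension dim B + 1, one more than half
of the dimension of the form. *)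
Lemma pfister_overlap q B (D : 'rV[F]_(bdim B)) i0 h s
    (Z : 'M[F]_(bdim B, qdim q)) u :
    bmx B = diag_mx D -> D 0 i0 = 1 -> s != 0 -> row_free Z ->
    (forall i, @qeval F q (row i Z) = s * D 0 i) ->
    (forall i j : 'I_(bdim B), (i < j)%N -> @polar F q (row i Z) (row j Z) = 0) ->
    (forall i, @polar F q (row i Z) u = s * (i == i0)%:R) ->
    qeval u = s * h ->
  overlap q (bqtens B (qbin 1 h)) s.
Proof.
move=> BD D1 s0 Zf qZ oZ uZ qu; have QZ := qeval_orthogonal_rows qZ oZ.
have PZ (x : 'rV_(bdim B)) : @polar F q (x *m Z) u = s * x 0 i0.
  rewrite polarE (mulmx_sum_row x) !mulmx_suml summxE (bigD1 i0) //= big1 => [|i ne].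
    by rewrite -!scalemxAl mxE -polarE uZ eqxx mulr1 addr0 mulrC.
  by rewrite -!scalemxAl mxE -polarE uZ (negPf ne) mulr0 mulr0.
pose J j := emb_right F (bdim B) (j : 'I_(1 + 1)).
pose j0 : 'I_(1 + 1) := lshift 1 0; pose j1 : 'I_(1 + 1) := rshift 1 0.
set gamma := bqtens B (qbin 1 h).
have gJ j (y : 'rV_(bdim B)) : @qeval F gamma (y *m J j)
    = qmx (qbin 1 h) j j * (y *m diag_mx D *m y^T) 0 0.
  rewrite -qeval_restr /qeval [qmx (restr _)]emb_rightE BD.
  by rewrite -scalemxAr -scalemxAl mxE.
have symB : (bmx B)^T = bmx B by rewrite BD tr_diag_mx.
have pJ (y z : 'rV_(bdim B)) : @polar F gamma (y *m J j0) (z *m J j1)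
    = (y *m diag_mx D *m z^T) 0 0.
  rewrite polarM gram_bqtens //.
  rewrite (@emb_rightE _ B (QForm (gram (qbin 1 h))) j0 j1).
  have -> : qmx (QForm (gram (qbin 1 h))) j0 j1 = 1.
    by rewrite /= mxE block_mxEur [X in _ + X]mxE block_mxEdl !mxE addr0.
  by rewrite scale1r BD.
exists (bdim B + 1)%N, (col_mx Z u), (col_mx (J j0) (delta_mx 0 i0 *m J j1)).
split=> [||x] /=; last first.
- rewrite -[x]hsubmxK !mul_row_col; set y := lsubmx x; set t := rsubmx x.
  rewrite [t]mx11_scalar !mul_scalar_mx scalemxAl; set k := t 0 0.
  rewrite !qevalD gJ gJ pJ qevalZ QZ polarZr PZ qu.
  have dl (z : 'rV_(bdim B)) :
      (z *m diag_mx D *m (delta_mx 0 i0 : 'rV_(bdim B))^T) 0 0 = z 0 i0.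
    by rewrite trmx_delta -colE mul_mx_diag !mxE D1 mulr1.
  have -> : qmx (qbin 1 h) j0 j0 = 1 by rewrite /= block_mxEul mxE eqxx.
  have -> : qmx (qbin 1 h) j1 j1 = h by rewrite /= block_mxEdr mxE eqxx.
  have scE (M : 'M[F]_1) : (k *: M) 0 0 = k * M 0 0 by rewrite mxE.
  have delta1 : (delta_mx 0 i0 : 'rV[F]_(bdim B)) 0 i0 = 1 by rewrite mxE !eqxx.
  by rewrite linearZ /= -!scalemxAr -!scalemxAl !scE !dl delta1; ring.
- lia.
apply: inj_row_free => x; rewrite -[x]hsubmxK mul_row_col.
set y := lsubmx x; set t := rsubmx x.
rewrite [t]mx11_scalar mul_scalar_mx; set k := t 0 0 => yk.
have k0 : k = 0.
  have := congr1 (fun v => polar v (row i0 Z)) yk.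
  rewrite polar0l polarDl polarZl (polarC u) uZ eqxx mulr1 rowE polarM.
  rewrite gram_orthogonal_rows // mulmx0 mul0mx.
  rewrite [(0 : 'M_1) _ _]mxE add0r => /eqP.
  by rewrite mulf_eq0 (negPf s0) orbF => /eqP.
move: yk; rewrite k0 scale0r addr0 => /eqP; rewrite mulmx_free_eq0 // => /eqP ->.
by rewrite raddf0 row_mx0.
Qed.

(** Anisotropy of D makes the rows of Z independent, so the
nondegenerate polar form provides u dual to the row i0; the value of q at u is then
taken as the definition of h. *)
Lemma anisotropic_diag_overlap q B (D : 'rV[F]_(bdim B)) i0 s
    (Z : 'M[F]_(bdim B, qdim q)) :
    nonsingular q -> bmx B = diag_mx D -> D 0 i0 = 1 -> s != 0 ->
    (forall x : 'rV_(bdim B), \sum_i D 0 i * x 0 i ^+ 2 = 0 -> x = 0) ->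
    (forall i, @qeval F q (row i Z) = s * D 0 i) ->
    (forall i j : 'I_(bdim B), (i < j)%N -> @polar F q (row i Z) (row j Z) = 0) ->
  exists h, overlap q (bqtens B (qbin 1 h)) s.
Proof.
move=> /nonsingularP uG BD D1 s0 anD qZ oZ.
have Zf : row_free Z.
  apply: inj_row_free => x xZ; apply: anD; rewrite -diag_form.
  have /eqP := qeval_orthogonal_rows qZ oZ x.
  by rewrite xZ qeval0 eq_sym mulf_eq0 (negPf s0) => /eqP.
have ZGf : row_free (Z *m gram q) by rewrite /row_free mxrankMfree ?row_free_unit.
pose u : 'rV[F]_(qdim q) := (pinvmx (Z *m gram q) *m (s *: delta_mx i0 0))^T.
exists (s^-1 * qeval u).
apply: (pfister_overlap (u := u) BD D1 s0 Zf qZ oZ) => [i|]; last by rewrite mulVKf.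
rewrite polarE rowE -!mulmxA [Z *m _]mulmxA trmxK [_ *m (pinvmx _ *m _)]mulmxA.
by rewrite mulmxVp // mul1mx -rowE !mxE eqxx andbT.
Qed.

Lemma binary_overlap q (g s : F) (x u : 'rV[F]_(qdim q)) :
    s != 0 -> qeval x = s -> polar x u = s -> qeval u = s * g ->
  overlap q (qbin 1 g) s.
Proof.
move=> s0 qx xu qu.
have eX (t : 'rV_(1 + 1)) : t *m col_mx x u = t 0 0 *: x + t 0 (rshift 1 0) *: u.
  rewrite -[t in LHS]hsubmxK mul_row_col [lsubmx t]mx11_scalar.
  rewrite [rsubmx t]mx11_scalar !mul_scalar_mx !mxE.
  by congr (t _ _ *: _ + _); apply: val_inj.
exists (1 + 1)%N, (col_mx x u), 1%:M; split=> // [|t]; last first.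
  rewrite mulmx1 qeval_qbin eX qevalD !qevalZ polarZl polarZr qx qu xu; ring.
apply: inj_row_free => t; rewrite eX => t0.
have := congr1 (fun v => polar v u) t0.
rewrite polar0l polarDl !polarZl xu polar_diag // mulr0 addr0 => /eqP.
rewrite mulf_eq0 (negPf s0) orbF => /eqP t00.
have := congr1 (fun v => polar v x) t0.
rewrite polar0l polarDl !polarZl (polarC u) xu polar_diag // mulr0 add0r => /eqP.
rewrite mulf_eq0 (negPf s0) orbF => /eqP t01.
apply/rowP => -[[|[|//]] lti]; rewrite mxE.
  by rewrite -[RHS]t00; congr (t _ _); apply: val_inj.
by rewrite -[RHS]t01; congr (t _ _); apply: val_inj.
Qed.

End Overlap.

(** * Generators sharing a large subform with a form of the kernel *)

Section GeneratorOverlap.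
Variables (F : fieldType) (E : fieldExtType F) (alpha : E) (a b c d : F).
Hypothesis char2 : 2%N \in [pchar F].
Hypothesis degE : \dim {:E} = 4%N.
Hypothesis free_alpha : forall u0 u1 u2 u3 : F,
  u0%:A + u1%:A * alpha + u2%:A * alpha ^+ 2 + u3%:A * alpha ^+ 3 = 0 ->
  [/\ u0 = 0, u1 = 0, u2 = 0 & u3 = 0].
Hypothesis quartic_alpha :
  alpha ^+ 4 + a%:A * alpha ^+ 3 + b%:A * alpha ^+ 2 + c%:A * alpha + d%:A = 0.
Implicit Types (q : qform F).

Lemma pcharE2 : 2%N \in [pchar E].
Proof. exact: (rmorph_pchar (in_alg E)). Qed.

Lemma cubic_resolventE e : (cubic_resolvent a b c d).[e] =
  e ^+ 3 + b * e ^+ 2 + a * c * e + (a ^+ 2 * d + c ^+ 2).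
Proof. by rewrite /cubic_resolvent !hornerE. Qed.

(** An identity in E modulo the minimal polynomial of alpha and
modulo 2; s and t are the cofactors. *)
Lemma eq_mod_quartic (s t u v : E) :
  u = v + s * (alpha ^+ 4 + a%:A * alpha ^+ 3 + b%:A * alpha ^+ 2
               + c%:A * alpha + d%:A) + 2%:R * t -> u = v.
Proof. by rewrite quartic_alpha mulr0 addr0; apply: (eq_mod2 pcharE2). Qed.

(** With N = [1, d/e^2] this says that
N(e alpha^2 + c alpha, e (e + a alpha)) = f_C(e) alpha^2.  The vector comes from
the isotropic vector of [resolvent_overlap]: in it alpha times the component of xP
orthogonal to the plane equals a vector of the plane. *)
Lemma resolvent_norm e :
  (e%:A * alpha ^+ 2 + c%:A * alpha) ^+ 2
  + (e%:A * alpha ^+ 2 + c%:A * alpha) * (e%:A * (e%:A + a%:A * alpha))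
  + d%:A * (e%:A + a%:A * alpha) ^+ 2
  = (cubic_resolvent a b c d).[e]%:A * alpha ^+ 2.
Proof.
rewrite cubic_resolventE -!in_algE !(rmorphD, rmorphM, rmorphXn) /=.
apply: (eq_mod_quartic (s := e%:A ^+ 2) (t :=
  c%:A * e%:A * alpha ^+ 3 + a%:A * d%:A * e%:A * alpha
   - b%:A * e%:A ^+ 2 * alpha ^+ 2)).
rewrite -!in_algE; ring.
Qed.

(** The form <1, g> is anisotropic over F as g is not a square in F. *)
Lemma sqrt_overlap q (x w : 'rV[F]_(qdim q)) g :
    nonsingular q -> qeval x != 0 -> qeval w = g * qeval x -> polar x w = 0 ->
    (exists y : E, y ^+ 2 = g%:A) -> (forall z, z ^+ 2 <> g) ->
  exists gamma s,
    [/\ s != 0, kernel_generator E a b c d gamma & overlap q gamma s].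
Proof.
move=> nsq qx qw xw sqE nsqF.
have g0 : g != 0 by apply/eqP => g0; apply: (nsqF 0); rewrite g0 expr0n.
pose Z : 'M[F]_(2, qdim q) := \matrix_i nth 0 [:: x; w] i.
have [||||h ov] := @anisotropic_diag_overlap _ char2 q (bpfister [:: g])
    (\row_(i < 2) [:: 1; - g]`_i) ord0 (qeval x) Z nsq (bpfister1E g) _ qx.
- by rewrite mxE.
- move=> t; rewrite !big_ord_recl big_ord0 !mxE /= mul1r addr0 => tg.
  have t1 : t 0 (lift ord0 ord0) = 0.
    apply/eqP/negPn/negP => t1; apply: (nsqF (t 0 ord0 / t 0 (lift ord0 ord0))).
    rewrite expr_div_n; apply: (canLR (mulfK _)); first by rewrite expf_eq0.
    by apply/eqP; rewrite -subr_eq0 -mulNr tg.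
  have t0 : t 0 ord0 = 0.
    by move: tg; rewrite t1 expr0n mulr0 addr0 => /eqP; rewrite sqrf_eq0 => /eqP.
  apply/rowP => -[[|[|//]] lti]; rewrite mxE.
    by rewrite -[RHS]t0; congr (t _ _); apply: val_inj.
  by rewrite -[RHS]t1; congr (t _ _); apply: val_inj.
- move=> [[|[|//]] lti]; rewrite rowK !mxE /= ?mulr1 //.
  by rewrite qw oppr_pchar2 // mulrC.
- by move=> [[|[|//]] lti] [[|[|//]] ltj] //= _; rewrite !rowK.
exists (qpfister [:: g] h), (qeval x); split=> //.
exact: Gen_sqrt.
Qed.

(** The vector v below is e times the component of w orthogonal to
the plane of x and y. *)
Lemma resolvent_overlap q (x w y : 'rV[F]_(qdim q)) :
    anisotropic q -> qeval x != 0 -> polar x y != 0 ->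
    polar x w = a * qeval x -> polar x y + qeval w = b * qeval x ->
    polar w y = c * qeval x -> qeval y = d * qeval x ->
  exists gamma s,
    [/\ s != 0, kernel_generator E a b c d gamma & overlap q gamma s].
Proof.
move=> an s0 xy0 xw xyw wy qy; set s := qeval x in s0 xw xyw wy qy *.
pose e := polar x y / s.
have e0 : e != 0 by rewrite mulf_neq0 ?invr_eq0.
have xy : polar x y = e * s by rewrite /e divfK.
have qw : qeval w = b * s + e * s.
  by apply: (eq_mod2 char2 (t := - (e * s))); rewrite -xyw xy; ring.
pose u := e^-1 *: y.
have xu : polar x u = s by rewrite polarZr xy mulKf.
have qu : qeval u = s * (d / e ^+ 2) by rewrite qevalZ qy exprVn; field.
(* Orthogonal to x and to u by the choice of the coefficients c and a. *)
pose v := e *: w + (c *: x + a *: y).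
have xv : polar x v = 0.
  rewrite !polarDr !polarZr xw xy polar_diag //.
  by apply: (eq_mod2 char2 (t := e * a * s)); ring.
have vu : polar v u = 0.
  rewrite !polarDl !polarZl !polarZr wy xy polar_diag //.
  by apply: (eq_mod2 char2 (t := c * s)); field.
have qv : qeval v = s * (cubic_resolvent a b c d).[e].
  rewrite !qevalD !qevalZ !(polarDr, polarZl, polarZr).
  rewrite (polarC w x) xw wy xy qy qw -/s cubic_resolventE.
  by apply: (eq_mod2 char2 (t := a * c * e * s)); ring.
have [v0 | /eqP v0] := classic (v = 0).
  exists (qbin 1 (d / e ^+ 2)), s; split=> //; last first.
    exact (binary_overlap char2 s0 (erefl _) xu qu).
  have fC0 : (cubic_resolvent a b c d).[e] = 0.
    by apply/eqP; move/eqP: qv; rewrite v0 qeval0 eq_sym mulf_eq0 (negPf s0).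
  have den0 : e%:A + a%:A * alpha != 0.
    apply: contraNneq e0 => den0; have [|-> //] := @free_alpha e a 0 0.
    by rewrite !scale0r !mul0r !addr0 den0.
  have := resolvent_norm e; rewrite fC0 scale0r mul0r => nrm.
  apply: Gen_artin_schreier.
  exists ((e%:A * alpha ^+ 2 + c%:A * alpha) / (e%:A * (e%:A + a%:A * alpha))).
  have eA0 : e%:A != 0 :> E by rewrite -in_algE fmorph_eq0.
  rewrite /root !hornerD hornerXn hornerX hornerC; apply/eqP.
  have -> : (d / e ^+ 2)%:A = d%:A / e%:A ^+ 2 :> E.
    by rewrite -!in_algE rmorphM fmorphV rmorphXn.
  rewrite -[RHS](mul0r ((e%:A * (e%:A + a%:A * alpha))^-1 ^+ 2)) -nrm.
  by field; rewrite eA0 den0.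
have fC0 : (cubic_resolvent a b c d).[e] != 0.
  by apply: contraNneq v0 => fC0; rewrite (an v) // qv fC0 mulr0.
set g := (cubic_resolvent a b c d).[e] in qv fC0.
exists (qpfister [:: g] (d / e ^+ 2)), s; split=> //; first exact: Gen_resolvent.
pose Z : 'M[F]_(2, qdim q) := \matrix_i nth 0 [:: x; v] i.
apply: (@pfister_overlap _ char2 q (bpfister [:: g])
  (\row_(i < 2) [:: 1; - g]`_i) ord0 (d / e ^+ 2) s Z u (bpfister1E g)) => //.
- by rewrite mxE.
- apply: inj_row_free => t.
  rewrite mulmx_sum_row !big_ord_recl big_ord0 !rowK /= addr0 => tZ.
  have := congr1 (fun z => polar z u) tZ.
  rewrite polar0l polarDl !polarZl xu vu mulr0 addr0 => /eqP.
  rewrite mulf_eq0 (negPf s0) orbF => /eqP t0.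
  have /eqP := tZ; rewrite t0 scale0r add0r scaler_eq0 (negPf v0) orbF => /eqP t1.
  apply/rowP => -[[|[|//]] lti]; rewrite mxE.
    by rewrite -[RHS]t0; congr (t _ _); apply: val_inj.
  by rewrite -[RHS]t1; congr (t _ _); apply: val_inj.
- move=> [[|[|//]] lti]; rewrite rowK !mxE /= ?mulr1 //.
  by rewrite qv oppr_pchar2.
- by move=> [[|[|//]] lti] [[|[|//]] ltj] //= _; rewrite !rowK.
- move=> [[|[|//]] lti]; rewrite rowK /=.
    by rewrite xu mulr1.
  by rewrite vu mulr0.
Qed.

(** Everything depends on whether <1, b, d, bd> is anisotropic, that
is, on whether b and d are 2-independent.  If b is a square in F, then d is one in E
but not in F; if d = l^2 + m^2 b with b not a square in F, then b is a square in E.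
Otherwise v, vR, vP, vRP span a form similar to <1, d, b, bd>. *)
Lemma mixed_overlap q (P R : 'M[F]_(qdim q)) (v : 'rV[F]_(qdim q)) :
    anisotropic q -> nonsingular q -> v != 0 -> mixed_case E a b c ->
    (forall x : 'rV_(qdim q), [/\ polar x (x *m P) = 0, polar x (x *m R) = 0,
       polar (x *m P) (x *m R) = 0, qeval (x *m P) = b * qeval x
       & qeval (x *m R) = d * qeval x]) ->
  exists gamma s,
    [/\ s != 0, kernel_generator E a b c d gamma & overlap q gamma s].
Proof.
move=> an nsq v0 mixed PR; have [_ _ [a0 c0 b0]] := mixed.
have qv0 : qeval v != 0 by apply: contraNneq v0 => /an ->.
have [[be be2] | nb] := classic (exists z, z ^+ 2 = b).
  have [_ xR _ _ qR] := PR v.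
  pose y := alpha ^+ 2 + be%:A * alpha.
  have y2 : y ^+ 2 = d%:A.
    apply: (eq_mod_quartic (s := 1) (t := be%:A * alpha ^+ 3 - d%:A)).
    by rewrite /y a0 c0 -be2 !scale0r -!in_algE rmorphXn /=; ring.
  apply: (sqrt_overlap nsq qv0 qR xR); first by exists y.
  move=> de de2; have : (y + de%:A) ^+ 2 = 0.
    apply: (eq_mod2 pcharE2 (t := y * de%:A + d%:A)).
    by rewrite sqrrD y2 -de2 -!in_algE rmorphXn /=; ring.
  move/eqP; rewrite sqrf_eq0 => /eqP y0.
  have [|_ _ /eqP] := @free_alpha de be 1 0; last by rewrite oner_eq0.
  by rewrite scale1r scale0r mul0r mul1r addr0 -[RHS]y0 /y; ring.
have [[l [m dlm]] | nd] := classic (exists l m, d = l ^+ 2 + m ^+ 2 * b).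
  have [xP _ _ qP _] := PR v.
  apply: (sqrt_overlap nsq qv0 qP xP); last by move=> z zb; apply: nb; exists z.
  have den0 : alpha + m%:A != 0.
    apply/eqP => den0; have [|_ /eqP] := @free_alpha m 1 0 0.
      by rewrite !scale0r !mul0r !addr0 scale1r mul1r addrC den0.
    by rewrite oner_eq0.
  exists ((alpha ^+ 2 + l%:A) / (alpha + m%:A)); rewrite expr_div_n.
  apply: (canLR (mulfK _)); first by rewrite expf_eq0.
  apply: (eq_mod_quartic (s := 1) (t := l%:A * alpha ^+ 2 - b%:A * alpha ^+ 2
    - b%:A * m%:A * alpha - m%:A ^+ 2 * b%:A)).
  rewrite a0 c0 dlm !scale0r -!in_algE rmorphD rmorphM !rmorphXn /=; ring.
(* The form <1, b> is anisotropic as b is not a square. *)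
have nrm y z : y ^+ 2 + b * z ^+ 2 = 0 -> y = 0 /\ z = 0.
  move=> yz; have z0 : z = 0.
    apply/eqP/negPn/negP => z0; apply: nb; exists (y / z).
    rewrite expr_div_n; apply: (canLR (mulfK _)); first by rewrite expf_eq0.
    exact: (eq_of_add0 char2).
  by move: yz; rewrite z0 expr0n mulr0 addr0 => /eqP; rewrite sqrf_eq0 => /eqP.
(* As b_q(x, xP) vanishes, P is self-adjoint. *)
have sym2 (x y : 'rV_(qdim q)) : polar (x *m P) y = polar x (y *m P).
  have [+ _ _ _ _] := PR (x + y); have [xP _ _ _ _] := PR x.
  have [yP _ _ _ _] := PR y; rewrite mulmxDl !(polarDl, polarDr) xP yP.
  by rewrite add0r addr0 => /(eq_of_add0 char2) ->; rewrite polarC.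
have simP (x y : 'rV_(qdim q)) : polar (x *m P) (y *m P) = b * polar x y.
  have [_ _ _ xP _] := PR x; have [_ _ _ yP _] := PR y.
  have [_ _ _ xyP _] := PR (x + y).
  by rewrite /polar -mulmxDl xyP xP yP; ring.
pose Z : 'M[F]_(4, qdim q) :=
  \matrix_i nth 0 [:: v; v *m R; v *m P; v *m R *m P] i.
have [vP vR vPR qP qR] := PR v; have [wP _ _ qRP _] := PR (v *m R).
have [||||h ov] := @anisotropic_diag_overlap _ char2 q (bpfister [:: b; d])
    (\row_(i < 4) [:: 1; - d; - b; b * d]`_i) ord0 (qeval v) Z nsq
    (bpfister2E b d) _ qv0.
- by rewrite mxE.
- move=> t; rewrite !big_ord_recl big_ord0 !mxE /= mul1r addr0.
  set t0 := t 0 ord0; set t1 := t 0 _; set t2 := t 0 _; set t3 := t 0 _ => tD.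
  have nt : t0 ^+ 2 + b * t2 ^+ 2 = d * (t1 ^+ 2 + b * t3 ^+ 2).
    apply: (eq_mod2 char2 (t := b * t2 ^+ 2 - b * d * t3 ^+ 2)).
    rewrite -[LHS]subr0 -[X in _ - X]tD; ring.
  have n0 : t1 ^+ 2 + b * t3 ^+ 2 = 0.
    apply/eqP/negPn/negP => n0; apply: nd.
    set n := t1 ^+ 2 + _ in nt n0.
    (* As n d = (t0 + t2 sqrt b)^2 and n = (t1 + t3 sqrt b)^2, the quotient
     of the two elements is a square root of d in F(sqrt b). *)
    exists ((t0 * t1 + b * t2 * t3) / n), ((t0 * t3 + t1 * t2) / n).
    rewrite !expr_div_n [_ * b]mulrAC -mulrDl; apply: (canRL (mulfK _)).
      by rewrite expf_eq0.
    apply/esym/(eq_mod2 char2 (t := 2%:R * b * t0 * t1 * t2 * t3)).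
    rewrite [n ^+ 2]expr2 [d * _]mulrA -nt /n; ring.
  have [t1E t3E] := nrm _ _ n0.
  move: nt; rewrite n0 mulr0 => /nrm[t0E t2E].
  apply/rowP => -[[|[|[|[|//]]]] lti]; rewrite mxE.
  + by rewrite -[RHS]t0E; congr (t _ _); apply: val_inj.
  + by rewrite -[RHS]t1E; congr (t _ _); apply: val_inj.
  + by rewrite -[RHS]t2E; congr (t _ _); apply: val_inj.
  + by rewrite -[RHS]t3E; congr (t _ _); apply: val_inj.
- move=> [[|[|[|[|//]]]] lti]; rewrite rowK !mxE /= ?mulr1 ?oppr_pchar2 //.
  + by rewrite qR mulrC.
  + by rewrite qP mulrC.
  + by rewrite qRP qR; ring.
- move=> [[|[|[|[|//]]]] lti] [[|[|[|[|//]]]] ltj] //= _; rewrite !rowK //=.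
  + by rewrite -sym2.
  + by rewrite polarC.
  + by rewrite simP vR mulr0.
exists (qpfister [:: b; d] h), (qeval v); split=> //.
exact: Gen_mixed.
Qed.

Hypothesis cases : separable_case E a b \/ mixed_case E a b c
             \/ purely_inseparable_case E a b c.

Lemma generator_overlap q :
    anisotropic q -> nonsingular q -> (0 < qdim q)%N -> lagrangian (qext E q) ->
  exists gamma s,
    [/\ s != 0, kernel_generator E a b c d gamma & overlap q gamma s].
Proof.
move=> an nsq q0 /(isotropic_quadratic_sections degE free_alpha an)[P [R secPR]].
have PR := section_identities free_alpha quartic_alpha secPR.
have qn0 (x : 'rV_(qdim q)) : x != 0 -> qeval x != 0.
  by apply: contraNneq => /an ->.
have [[x xR] | xR0] := classic (exists x : 'rV_(qdim q), polar x (x *m R) != 0).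
  have x0 : x != 0 by apply: contraNneq xR => ->; rewrite polar0l.
  have [xP xRP PRx qR] := PR x.
  exact: (resolvent_overlap an (qn0 _ x0) xR xP xRP PRx qR).
have {}xR0 (x : 'rV_(qdim q)) : polar x (x *m R) = 0.
  by apply/eqP/negPn/negP => xR; apply: xR0; exists x.
have qP (x : 'rV_(qdim q)) : qeval (x *m P) = b * qeval x.
  by have [_ + _ _] := PR x; rewrite xR0 add0r.
have [v v0] : exists v : 'rV[F]_(qdim q), v != 0.
  exists (delta_mx 0 (Ordinal q0)); apply/eqP => /rowP/(_ (Ordinal q0))/eqP.
  by rewrite !mxE !eqxx oner_eq0.
have qv0 := qn0 _ v0.
case: cases => [[_ [b0 a0]] | [mixed | [_ [a0 b0 c0]]]].
- have vP : v *m P = 0 by apply: an; rewrite qP b0 mul0r.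
  have [+ _ _ _] := PR v; rewrite vP polarC polar0l => /eqP.
  by rewrite eq_sym mulf_eq0 (negPf a0) (negPf qv0).
- have [_ _ [a0 c0 _]] := mixed.
  apply: (mixed_overlap (P := P) (R := R) an nsq v0 mixed) => x.
  by have [xP _ xPR ?] := PR x; split=> //; rewrite ?xP ?xPR ?a0 ?c0 mul0r.
have [_ _ _ qR] := PR v.
have a4 : alpha ^+ 4 = d%:A.
  apply: (eq_mod_quartic (s := 1) (t := - d%:A)).
  by rewrite a0 b0 c0 !scale0r; ring.
apply: (sqrt_overlap nsq qv0 qR (xR0 v)).
  by exists (alpha ^+ 2); rewrite -exprM.
move=> z zd; have : (alpha ^+ 2 + z%:A) ^+ 2 = 0.
  apply: (eq_mod2 pcharE2 (t := alpha ^+ 2 * z%:A + d%:A)).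
  by rewrite sqrrD -exprM a4 -zd -!in_algE rmorphXn /=; ring.
move/eqP; rewrite sqrf_eq0 => /eqP y0.
have [|_ _ /eqP] := @free_alpha z 0 1 0; last by rewrite oner_eq0.
by rewrite scale1r !scale0r !mul0r mul1r !addr0 addrC.
Qed.

End GeneratorOverlap.

(** * The kernel and the span of the generators *)

(** The common part of q and s gamma embeds diagonally in their
orthogonal sum, and is totally singular there. *)
Lemma overlap_reduction (F : fieldType) (char2 : 2%N \in [pchar F])
    (q gamma : qform F) (s : F) :
    s != 0 -> nonsingular q -> nonsingular gamma -> overlap q gamma s ->
  exists q', [/\ nonsingular q', (qdim q' < qdim q)%N
    & witt_rel (qorth q (bqtens (bdiag [:: s]) gamma)) q'].
Proof.
move=> s0 nsq nsg [r [X [Y [Xf dr XY]]]].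
have nsB : nonsingular_symmetric (bdiag [:: s]).
  by apply: nonsingular_symmetric_diag => i; rewrite mxE (ord1 i).
pose J := emb_left F (qdim gamma) (ord0 : 'I_1).
have qJ y : @qeval F (bqtens (bdiag [:: s]) gamma) (y *m J) = s * qeval y.
  rewrite -qeval_restr /qeval [qmx (restr _)]emb_leftE.
  by rewrite -scalemxAr -scalemxAl !mxE eqxx mulr1n.
have nsqg : nonsingular (qorth q (bqtens (bdiag [:: s]) gamma)).
  by apply/nonsingular_orth; split=> //; apply: nonsingular_bqtens.
have [||q' [nsq' dq' rel]] := totally_singular_reduction
    (U := row_mx X (Y *m J) : 'M_(r, qdim (qorth q (bqtens (bdiag [:: s]) gamma))))
    char2 nsqg.
- apply: inj_row_free => v; rewrite mul_mx_row => /(congr1 lsubmx).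
  by rewrite row_mxKl linear0 => /eqP; rewrite (mulmx_free_eq0 _ Xf) => /eqP.
- move=> x; rewrite qeval_orth mul_mx_row row_mxKl row_mxKr mulmxA qJ XY.
  exact: addrr2.
exists q'; split=> //; move: dq' dr; rewrite /= ; lia.
Qed.

Section Kernel.
Variables (F : fieldType) (E : fieldExtType F) (alpha : E) (a b c d : F).
Hypothesis char2 : 2%N \in [pchar F].
Hypothesis degE : \dim {:E} = 4%N.
Hypothesis free_alpha : forall u0 u1 u2 u3 : F,
  u0%:A + u1%:A * alpha + u2%:A * alpha ^+ 2 + u3%:A * alpha ^+ 3 = 0 ->
  [/\ u0 = 0, u1 = 0, u2 = 0 & u3 = 0].
Hypothesis quartic_alpha :
  alpha ^+ 4 + a%:A * alpha ^+ 3 + b%:A * alpha ^+ 2 + c%:A * alpha + d%:A = 0.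
Hypothesis cases : separable_case E a b \/ mixed_case E a b c
             \/ purely_inseparable_case E a b c.

Lemma alpha_neq0 : alpha != 0.
Proof.
apply/eqP => alpha0; have [|_ /eqP] := @free_alpha 0 1 0 0.
  by rewrite alpha0 !expr0n !scale0r /= !mulr0 !addr0.
by rewrite oner_eq0.
Qed.

Lemma constant_coef_neq0 : d != 0.
Proof.
apply/eqP => d0; have [|_ _ _ /eqP] := @free_alpha c b a 1.
  apply: (mulfI alpha_neq0); rewrite mulr0 -[RHS]quartic_alpha d0 scale0r scale1r.
  ring.
by rewrite oner_eq0.
Qed.

Lemma generator_in_kernel gamma : kernel_generator E a b c d gamma ->
  nonsingular gamma /\ lagrangian (qext E gamma).
Proof.
have ns s h : all (fun x => x != 0) s -> nonsingular (@qpfister F s h).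
  move=> s0; apply: nonsingular_bqtens; first exact: nonsingular_symmetric_bpfister.
  exact: nonsingular_qbin.
case=> [g [x rx]|g h g0 [x xg]|e e0 fC0|h mixed].
- split; first exact: nonsingular_qbin.
  rewrite qext_qbin scale1r; apply: (lagrangian_qbin (x := x)).
  by move: rx; rewrite /root !hornerD hornerXn hornerX hornerC => /eqP.
- split; first by apply: ns; rewrite /= g0.
  rewrite qext_qpfister; exact: lagrangian_qpfister_sqr xg.
- split; first by apply: ns; rewrite /= fC0.
  rewrite qext_qpfister.
  apply: (lagrangian_qpfister_norm (pcharE2 E char2)
    (z1 := (e%:A * alpha ^+ 2 + c%:A * alpha) / alpha)
    (z2 := e%:A * (e%:A + a%:A * alpha) / alpha)).
  have eA0 : e%:A != 0 :> E by rewrite -in_algE fmorph_eq0.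
  apply: (mulIf (expf_neq0 2 alpha_neq0)).
  rewrite -(resolvent_norm char2 quartic_alpha e).
  have -> : (d / e ^+ 2)%:A = d%:A / e%:A ^+ 2 :> E.
    by rewrite -!in_algE rmorphM fmorphV rmorphXn.
  by field; rewrite eA0 alpha_neq0.
have [_ _ [a0 c0 b0]] := mixed.
split; first by apply: ns; rewrite /= b0 constant_coef_neq0.
rewrite qext_qpfister; apply: (lagrangian_qpfister2 (pcharE2 E char2)).
by rewrite -[RHS]quartic_alpha a0 c0 !scale0r !mul0r !addr0.
Qed.

(** Scalar extension commutes with the action of bilinear forms, and
tensoring preserves totally singular halves. *)
Lemma span_in_kernel n (B : 'I_n -> bform F) (G : 'I_n -> qform F) :
    (forall i, nonsingular_symmetric (B i)) ->
    (forall i, kernel_generator E a b c d (G i)) ->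
  let q := \big[@qorth F/qzero F]_(i < n) bqtens (B i) (G i) in
  nonsingular q /\ lagrangian (qext E q).
Proof.
move=> nsB GS /=; apply: (big_ind (fun q => nonsingular q /\ lagrangian (qext E q))).
- split; first by move=> x _; apply/rowP; case.
  exact/lagrangian_qext/lagrangian_qzero.
- move=> q1 q2 [ns1 l1] [ns2 l2]; rewrite qext_orth.
  by split; [apply/nonsingular_orth | apply: lagrangian_orth].
move=> i _; have [nsG lG] := generator_in_kernel (GS i).
split; first exact: nonsingular_bqtens.
rewrite qext_bqtens; apply: lagrangian_bqtens lG => /=.
by rewrite map_trmx (nsB i).1.
Qed.

(** Induction on the dimension of q.  An isotropic q is Witt equivalent
to a smaller form; an anisotropic one becomes smaller after adding a multiple
s gamma of a generator, and s gamma is then moved to the other side. *)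
Lemma kernel_in_span q : nonsingular q -> lagrangian (qext E q) ->
  exists n (B : 'I_n -> bform F) (G : 'I_n -> qform F),
    [/\ forall i, nonsingular_symmetric (B i),
        forall i, kernel_generator E a b c d (G i)
      & witt_rel q (\big[@qorth F/qzero F]_(i < n) bqtens (B i) (G i))].
Proof.
have [m] := ubnP (qdim q); elim: m q => // m IHm q /ltnSE le_m nsq lagq.
have [an | nan] := classic (anisotropic q); last first.
  have [x qx x0] : exists2 x, @qeval F q x = 0 & x <> 0.
    apply: NNPP => H; apply: nan => x qx; apply: NNPP => x0.
    by apply: H; exists x.
  have [||q' [nsq' dq' rel]] := totally_singular_reduction (U := x) char2 nsq.
  - apply: inj_row_free => t; rewrite [t]mx11_scalar mul_scalar_mx => /eqP.
    by rewrite scaler_eq0 => /orP[/eqP->|/eqP//]; rewrite raddf0.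
  - by move=> t; rewrite [t]mx11_scalar mul_scalar_mx qevalZ qx mulr0.
  have [|//||n [B [G [nsB GS rel']]]] := IHm q'; first by move: dq' le_m; lia.
    exact: (lagrangian_witt_rel (pcharE2 E char2) (nonsingular_qext (E := E) nsq)
      (witt_rel_qext E rel) lagq).
  exists n, B, G; split=> //; exact: (witt_rel_trans char2 nsq' rel rel').
have [q0 | qn0] := posnP (qdim q).
  exists 0%N, (fun=> bdiag [::]), (fun=> qzero F); split; try by case.
  rewrite big_ord0; exists 0%N, 0; split=> [||x] /=.
  - by rewrite /row_free mxrank0.
  - by rewrite q0.
  - by rewrite mulmx0 qeval0.
have [gamma [s [s0 gen ov]]] :=
  generator_overlap char2 degE free_alpha quartic_alpha cases an nsq qn0 lagq.
have [nsg lagg] := generator_in_kernel gen.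
have [q' [nsq' dq' rel]] := overlap_reduction char2 s0 nsq nsg ov.
have nsB : nonsingular_symmetric (bdiag [:: s]).
  by apply: nonsingular_symmetric_diag => i; rewrite mxE (ord1 i).
have nsqg : nonsingular (qorth q (bqtens (bdiag [:: s]) gamma)).
  by apply/nonsingular_orth; split=> //; apply: nonsingular_bqtens.
have [|//||n [B [G [nsBs GS rel']]]] := IHm q'; first exact: leq_trans dq' le_m.
  apply: (lagrangian_witt_rel (pcharE2 E char2) (nonsingular_qext (E := E) nsqg)
    (witt_rel_qext E rel)).
  rewrite qext_orth qext_bqtens; apply: lagrangian_orth => //.
  by apply: lagrangian_bqtens => //=; rewrite map_trmx nsB.1.
exists n.+1, (fun i => if unlift ord0 i is Some j then B j else bdiag [:: s]),
  (fun i => if unlift ord0 i is Some j then G j else gamma).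
split=> [i|i|]; try by case: unliftP.
rewrite big_ord_recl unlift_none.
under eq_bigr => i _ do rewrite liftK.
(* The sum of q and s gamma is equivalent to q', and q' to the sum of the B_i G_i. *)
apply: (lagrangian_isometric (isometric_sym (isometric_orthA _ _ _))).
exact: (witt_rel_trans char2 nsq' rel rel').
Qed.

End Kernel.

Theorem theorem5p4 (F : fieldType) (charF2 : 2%N \in [pchar F])
    (E : fieldExtType F) (alpha : E) (a b c d : F)
    (simpleE : <<1; alpha>>%VS = {:E}%VS)
    (degE : \dim {:E} = 4%N)
    (minPoly_alpha : minPoly 1 alpha = map_poly (in_alg E) (quartic a b c d))
    (cases : separable_case E a b \/ mixed_case E a b c
             \/ purely_inseparable_case E a b c) :
  generates_witt_kernel E (kernel_generator E a b c d).
Proof.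
have quartic_alpha :
    alpha ^+ 4 + a%:A * alpha ^+ 3 + b%:A * alpha ^+ 2 + c%:A * alpha + d%:A = 0.
  have /rootP := root_minPoly 1 alpha; rewrite minPoly_alpha /quartic.
  rewrite !rmorphD /= !map_polyZ !map_polyXn map_polyX map_polyC /=.
  by rewrite !hornerD !hornerZ !hornerXn hornerX hornerC.
have free_alpha (u0 u1 u2 u3 : F) :
    u0%:A + u1%:A * alpha + u2%:A * alpha ^+ 2 + u3%:A * alpha ^+ 3 = 0 ->
    [/\ u0 = 0, u1 = 0, u2 = 0 & u3 = 0].
  move=> u0123; pose p := \poly_(i < 4) [:: u0; u1; u2; u3]`_i.
  have rp : root (map_poly (in_alg E) p) alpha.
    rewrite /root (horner_coef_wide _ (n := 4)); last first.
      by rewrite size_map_poly size_poly.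
    rewrite !big_ord_recl big_ord0 !coef_map !coef_poly /=.
    by rewrite expr0 mulr1 expr1 addr0 !addrA u0123.
  have size_min : size (minPoly 1 alpha) = 5%N.
    by rewrite size_minPoly adjoin_degreeE simpleE dimv1 divn1 degE.
  have p0 : p = 0.
    apply/eqP/negPn/negP => p0.
    have := dvdp_leq _ (minPoly_dvdp (alg_polyOver 1 p) rp).
    rewrite map_poly_eq0 p0 size_min size_map_poly => /(_ isT).
    by rewrite leqNgt ltnS size_poly.
  have cp i : p`_i = 0 by rewrite p0 coef0.
  have := (cp 0%N, cp 1%N, cp 2%N, cp 3%N).
  by rewrite !coef_poly /= => -[[[-> ->] ->] ->].
move=> q nsq; have nsqE := nonsingular_qext (E := E) nsq.
have charE2 := pcharE2 E charF2.
rewrite /in_witt_kernel witt_equiv0P //; split=> [lagq | [n [B [G [nsB GS eqv]]]]].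
  have [n [B [G [nsB GS rel]]]] :=
    kernel_in_span charF2 degE free_alpha quartic_alpha cases nsq lagq.
  have [nsT _] := span_in_kernel charF2 free_alpha quartic_alpha nsB GS.
  by exists n, B, G; split=> //; apply/witt_equivP.
have [nsT lagT] := span_in_kernel charF2 free_alpha quartic_alpha nsB GS.
apply: (lagrangian_witt_rel charE2 (nonsingular_qext (E := E) nsT)) lagT.
apply/witt_rel_sym/witt_rel_qext; exact/witt_equivP.
Qed.
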